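(* Let $G$ be a finite group. If every Schmidt subgroup of $G$ is subnormal in $G$ or modular in $G$, then the quotient group $G/F(G)$ is cyclic.
   Context: All groups are finite. A Schmidt group is a non-nilpotent group all of whose proper subgroups are nilpotent. A Schmidt subgroup of $G$ is a subgroup of $G$ that is a Schmidt group. $F(G)$ denotes the Fitting subgroup of $G$ (the largest nilpotent normal subgroup). A subgroup $M$ of $G$ is modular in $G$ if $M$ is a modular element of the lattice of subgroups of $G$, that is, (i) $\langle X, M\cap Z\rangle=\langle X,M\rangle\cap Z$ for all subgroups $X\le Z\le G$, and (ii) $\langle M, Y\cap Z\rangle=\langle M,Y\rangle\cap Z$ for all subgroups $Y, Z\le G$ with $M\le Z$. The hypothesis is understood for each Schmidt subgroup separately: each one is subnormal or modular in $G$ (some may be subnormal and others modular). *)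

(* Defs.v *)
From mathcomp Require Import all_boot all_fingroup all_solvable.

Set Implicit Arguments.
Unset Strict Implicit.
Unset Printing Implicit Defensive.

Local Open Scope group_scope.

Definition schmidt_group (gT : finGroupType) (S : {group gT}) : bool :=
  ~~ nilpotent S && [forall (H : {group gT} | H \proper S), nilpotent H].

(* M is a modular element of the subgroup lattice of G; the joins and meets
   below are compared as sets, which is equality of subgroups. *)
Definition modular_subgroup (gT : finGroupType) (M G : {group gT}) : Prop :=
  [/\ M \subset G,
      forall X Z : {group gT}, X \subset Z -> Z \subset G ->
        X <*> (M :&: Z) = (X <*> M) :&: Z
    & forall Y Z : {group gT}, Y \subset G -> Z \subset G -> M \subset Z ->
        M <*> (Y :&: Z) = (M <*> Y) :&: Z].

(* Main.v *)
Require Import Defs.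
From mathcomp Require Import all_boot all_fingroup all_solvable.
From mathcomp Require Import ssralg finalg zmodp.
From mathcomp Require Import mxrepresentation mxabelem vcharacter.

Set Implicit Arguments.
Unset Strict Implicit.
Unset Printing Implicit Defensive.

Local Open Scope group_scope.

(** Write (H) for the hypothesis that every Schmidt subgroup is subnormal or
    modular, [schmidt_subnormal_or_modular] below.

    (H) passes to subgroups and to quotients.  For a quotient G / N, a Schmidt
    subgroup of G / N is the image of some K <= G chosen minimal; then K :&: N
    lies in the Frattini subgroup of K, and a Schmidt subgroup T of K has
    normal closure K.  If T is subnormal then T = K.  If T is modular then K,
    the join of the conjugates of T, is modular, because joins of modular
    subgroups are modular ([modularY]).  One can therefore argue by induction
    on the order of G.

    (H) implies solvability.  Otherwise a minimal example G is simple; take a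
    Schmidt subgroup T of G.  If T = G, the maximal subgroups of G are nilpotent
    and meet trivially in pairs, so G is a Frobenius group and is not simple
    ([simple_min_nonnilpotent_sol]).  So T is proper; it is not subnormal, hence
    it is modular, and then G has a maximal subgroup M that is modular
    ([simple_modular_maximal]).  Any subgroup Z is either contained in a given
    conjugate of M or cut by it in a maximal subgroup of Z, while the
    intersection of the conjugates is trivial.  For the least prime divisor p
    of #|G| this makes a Sylow p-subgroup abelian and central in its normaliser,
    against the transfer theorem of Burnside ([simple_maximal_modular_sol]).

    Let now G be a solvable group satisfying (H), with the theorem known for
    its proper subgroups and proper quotients.  If Phi(G) is nontrivial, one
    divides by it: the Fitting subgroup of the quotient is the image of that of
    G.  Otherwise there are two cases.

    If G has two minimal normal subgroups N1 and N2, let Li / Ni be the Fitting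
    subgroup of G / Ni.  Then L1 :&: L2 = 'F(G), so G / 'F(G) is abelian, and if
    it is not cyclic it is an elementary abelian r-group; L1 and L2 are maximal
    subgroups, centralising N2 and N1 respectively.  The picture to keep in mind
    is S_3 x S_3: choose r-elements a in L1 and b in L2 outside 'F(G); the
    diagonal Schmidt subgroup N1 * <[a * b]> is neither subnormal nor modular
    ([two_minnormal_contradiction]).

    If N is the only minimal normal subgroup, then G = N ><| H with H acting
    faithfully and irreducibly on the p-group N, and 'O_p(H) = 1.  Testing (H)
    on the Schmidt subgroups N0 * <[y]>, with y in H of prime order q <> p,
    shows that [N, y] is y-irreducible ([commg_prime_minnormal]), and even that
    N is y-irreducible if y is central in 'O_q(H) ([central_prime_irreducible]).
    By an argument of Schur type the centraliser of such a y in H is abelian,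
    hence cyclic.  It is all of H: otherwise some x of H normalises <[y]> and
    <[y]> * <[x]> is a Schmidt subgroup; it cannot be subnormal, and it can
    only be modular if N is cyclic, which makes H abelian anyway
    ([primitive_compl_cyclic]).  So G / 'F(G), a quotient of H, is cyclic. *)

(** * Modular subgroups *)

Section Modular.

Variable gT : finGroupType.
Implicit Types G H K L M N P S T U X Y Z : {group gT}.

Lemma modularJ G M x : x \in G -> modular_subgroup M G ->
  modular_subgroup (M :^ x)%G G.
Proof.
move=> Gx [sMG mod1 mod2].
have JG (A : {set gT}) : A \subset G -> A :^ x^-1 \subset G.
  by move=> sAG; rewrite -(conjGid (groupVr Gx)) conjSg.
split=> [|X Z sXZ sZG|Y Z sYG sZG sMZ] /=.
- by rewrite -(conjGid Gx) conjSg.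
- apply: (@conjsg_inj _ x^-1).
  rewrite conjIg !conjYg conjIg conjsgK.
  have := mod1 (X :^ x^-1)%G (Z :^ x^-1)%G.
  by rewrite /= conjSg; apply=> //; apply: JG.
- apply: (@conjsg_inj _ x^-1).
  rewrite conjIg !conjYg conjIg conjsgK.
  have := mod2 (Y :^ x^-1)%G (Z :^ x^-1)%G.
  by apply=> /=; rewrite ?JG // -sub_conjg.
Qed.

Lemma modularS G H M : M \subset H -> H \subset G -> modular_subgroup M G ->
  modular_subgroup M H.
Proof.
move=> sMH sHG [sMG mod1 mod2]; split=> // [X Z sXZ sZH|Y Z sYH sZH sMZ].
  by apply: mod1 => //; apply: subset_trans sHG.
by apply: mod2 => //; [apply: subset_trans sHG | apply: subset_trans sHG].
Qed.

(** Condition (i) is the delicate one.  Replacing M by M' := M :&: (Z <*> N)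
    changes neither side and puts Y := M' <*> N inside Z <*> N; then
    Y = N <*> (Y :&: Z) by (ii) for N, and (i) for N finishes. *)
Lemma modularY G M N : modular_subgroup M G -> modular_subgroup N G ->
  modular_subgroup (M <*> N)%G G.
Proof.
move=> [sMG modM1 modM2] [sNG modN1 modN2].
have sMNG : M <*> N \subset G by rewrite join_subG sMG.
split=> //= [X Z sXZ sZG|Y Z sYG sZG].
  have sXG := subset_trans sXZ sZG.
  pose M' := (M :&: (Z <*> N))%G; pose Y := (M' <*> N)%G.
  have sM'G : M' \subset G by apply: subset_trans sMG; apply: subsetIl.
  have sYG : Y \subset G by rewrite join_subG sM'G.
  have sZNG : Z <*> N \subset G by rewrite join_subG sZG.
  have eY : Y :=: (M <*> N) :&: (Z <*> N).
    have /= := modM1 N (Z <*> N)%G; rewrite joing_subr => e.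
    by rewrite (joingC (M :&: _)) e // (joingC N).
  have eXY : X <*> Y :=: (X <*> (M <*> N)) :&: (Z <*> N).
    have /= := modM1 (X <*> N)%G (Z <*> N)%G; rewrite genS ?setSU // => e.
    by rewrite (joingC (M :&: _)) joingA e // -joingA (joingC N).
  have sYZN : Y \subset Z <*> N by rewrite eY subsetIr.
  have eYZ : (M <*> N) :&: Z = Y :&: Z.
    by rewrite eY -setIA (setIidPr (joing_subl Z N)).
  have eXYZ : (X <*> (M <*> N)) :&: Z = (X <*> Y) :&: Z.
    by rewrite eXY -setIA (setIidPr (joing_subl Z N)).
  have genY : Y :=: N <*> (Y :&: Z).
    rewrite setIC (modN2 Z Y) ?joing_subr //.
    by rewrite joingC (setIidPr sYZN).
  pose B := (X <*> (Y :&: Z))%G.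
  have sBZ : B \subset Z by rewrite join_subG sXZ subsetIr.
  have eB : X <*> Y = B <*> N.
    by rewrite {1}genY /= -joingA; congr (_ <*> _); rewrite joingC.
  have sNB : N :&: Z \subset B.
    by apply: subset_trans (joing_subr _ _); rewrite setSI ?joing_subr.
  by rewrite eYZ eXYZ eB -(modN1 B Z) //; apply/esym/joing_idPl.
rewrite join_subG => /andP[sMZ sNZ].
by rewrite -joingA modN2 // (modM2 (N <*> Y)%G) ?join_subG ?sNG //= joingA.
Qed.

Lemma quotient_modular G M N : N <| G -> modular_subgroup M G ->
  modular_subgroup (M / N)%G (G / N)%G.
Proof.
move=> nsNG [sMG mod1 mod2]; have [sNG nNG] := andP nsNG.
have nNM := subset_trans sMG nNG.
have preG (A : {group coset_of N}) : A \subset G / N -> coset N @*^-1 A \subset G.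
  by move=> sAG; rewrite sub_cosetpre_quo.
split=> [|X Z sXZ sZG|Y Z sYG sZG sMZ] /=; first exact: quotientS.
- have sN_Z : N \subset coset N @*^-1 Z by apply: sub_cosetpre.
  have sZ_G := preG _ sZG.
  have nZ := subset_trans sZ_G nNG.
  have sXZ' : coset N @*^-1 X \subset coset N @*^-1 Z by rewrite morphpreS.
  have nX := subset_trans sXZ' nZ.
  have nMZ : M :&: coset N @*^-1 Z \subset 'N(N) by rewrite subIset // nNM.
  have := mod1 _ _ sXZ' sZ_G => /= /(congr1 (fun A => A / N)).
  by rewrite quotientIG // !quotientY // !quotientIG // !cosetpreK.
- have sN_Z : N \subset coset N @*^-1 Z by apply: sub_cosetpre.
  have sZ_G := preG _ sZG.
  have sY_G := preG _ sYG.
  have sMZ' : M \subset coset N @*^-1 Z by rewrite -sub_quotient_pre.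
  have nY := subset_trans sY_G nNG.
  have nYZ : coset N @*^-1 Y :&: coset N @*^-1 Z \subset 'N(N) by rewrite subIset // nY.
  have := mod2 _ _ sY_G sZ_G sMZ' => /= /(congr1 (fun A => A / N)).
  by rewrite quotientIG // !quotientY // !quotientIG // !cosetpreK.
Qed.

(** The subgroup L is obtained by joining M with its K-conjugates, one at a
    time. *)
Lemma modular_normal_hull G M K : M \subset K -> K \subset G ->
  modular_subgroup M G ->
  exists2 L : {group gT}, M \subset L /\ L <| K & modular_subgroup L G.
Proof.
have [n] := ubnP (#|K| - #|M|); elim: n => // n IHn in M *.
rewrite ltnS => leKMn sMK sKG modM.
have [nMK | /subsetPn[k Kk nMk]] := boolP (K \subset 'N(M)).
  by exists M => //; split; rewrite // /normal sMK.
have [||||L [sML nsLK] modL] := IHn (M <*> M :^ k)%G; last 1 first.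
- by exists L; rewrite // (subset_trans _ sML) ?joing_subl.
- have sJK : M <*> M :^ k \subset K by rewrite join_subG sMK -(conjGid Kk) conjSg.
  apply: leq_trans leKMn; apply: ltn_sub2l.
    rewrite (leq_trans _ (subset_leq_card sJK)) // proper_card //.
    rewrite properE joing_subl join_subG subxx /=.
    by apply: contra nMk => sMkM; rewrite inE.
  rewrite proper_card // properE joing_subl join_subG subxx /=.
  by apply: contra nMk => sMkM; rewrite inE.
- by rewrite join_subG sMK -(conjGid Kk) conjSg.
- exact: sKG.
apply: modularY => //; apply: modularJ => //.
exact: (subsetP sKG).
Qed.

(** * Schmidt subgroups, Frattini arguments and commutators *)

Lemma schmidtP S : reflect
  (~~ nilpotent S /\ forall H, H \proper S -> nilpotent H) (schmidt_group S).
Proof.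
apply: (iffP andP) => [[-> /forall_inP nilS] | [-> nilS]]; split=> //.
exact/forall_inP.
Qed.

Lemma schmidt_exists G : ~~ nilpotent G ->
  exists2 S : {group gT}, S \subset G & schmidt_group S.
Proof.
pose gP (H : {group gT}) := ~~ nilpotent H.
move=> nnG; have [S /mingroupP[nnS minS] sSG] := mingroup_exists (nnG : gP G).
exists S => //; apply/schmidtP; split=> // H /andP[sHS nsSH].
by apply: contraR nsSH => nnH; rewrite (minS H nnH sHS).
Qed.

(** A Sylow subgroup of L is Sylow in the normal subgroup B of K that it
    generates with L :&: N, so the Frattini argument gives K = 'Phi(K) 'N_K(P)
    and P is normal in K. *)
Lemma nilpotent_quo_sub_Phi K L N : L <| K -> K \subset 'N(N) ->
  K :&: N \subset 'Phi(K) -> nilpotent (L / N) -> nilpotent L.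
Proof.
move=> nsLK nNK sKNPhi nilLN; have [sLK nLK] := andP nsLK.
suff sLF : L \subset 'F(L).
  exact: nilpotentS sLF (Fitting_nil L).
rewrite -{1}(Sylow_gen L) gen_subG; apply/bigcupsP=> P /SylowP[p p_pr sylP].
have [sPL pP _] := and3P sylP.
apply: Fitting_max (pgroup_nil pP).
rewrite /normal sPL (subset_trans sLK) //.
have nNL := subset_trans sLK nNK.
have nNP := subset_trans sPL nNL.
have sylPN : p.-Sylow(L / N) (P / N) := quotient_pHall nNP sylP.
have chPN : P / N \char L / N.
  by rewrite (nilpotent_Hall_pcore nilLN sylPN) pcore_char.
have nsPN : P / N <| K / N := char_normal_trans chPN (quotient_normal _ nsLK).
pose B := (L :&: coset N @*^-1 (P / N))%G.
have nsBK : B <| K.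
  have nsPre : coset N @*^-1 (P / N) <| coset N @*^-1 (K / N).
    by rewrite cosetpre_normal.
  have sKpre : K \subset coset N @*^-1 (K / N) by rewrite -sub_quotient_pre.
  rewrite /normal subIset ?sLK //= normsI //.
  exact: subset_trans sKpre (normal_norm nsPre).
have sylB : p.-Sylow(B) P.
  apply: pHall_subl sylP; last exact: subsetIl.
  by rewrite subsetI sPL /= -sub_quotient_pre.
have sBPN : B \subset (K :&: N) * P.
  rewrite /= quotientK //; apply/subsetP=> nx /setIP[Lnx /mulsgP[n x Nn Px def_nx]].
  rewrite {}def_nx in Lnx *.
  rewrite mem_mulg // inE Nn andbT (subsetP sLK) //.
  by rewrite -(groupMr _ (subsetP sPL x Px)).
have defK : 'Phi(K) <*> 'N_K(P) = K.
  apply/eqP; rewrite eqEsubset join_subG Phi_sub subsetIl /=.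
  rewrite -{1}(Frattini_arg nsBK sylB) mul_subG ?joing_subr //.
  apply: subset_trans sBPN _; rewrite mul_subG //.
    by apply: subset_trans sKNPhi (joing_subl _ _).
  apply: subset_trans (joing_subr _ _).
  by rewrite subsetI (subset_trans sPL sLK) normG.
have := Phi_nongen defK; rewrite genGid => /= defNK.
by rewrite -defNK subsetIr.
Qed.

(** Going down a subnormal series from G to T, each term K containing C is
    followed by a normal subgroup of K that contains [~: C, A]. *)
Lemma subnormal_comm_sub G T (A C : {group gT}) :
    T <|<| G -> C \subset G -> A \subset T ->
  C \subset [~: C, A] -> C \subset T.
Proof.
case/subnormalP=> s; elim: s T => [|K s IHs] T /=; first by move=> _ ->.
case/andP=> nsTK ser_s lastG sCG sAT sCCA.
have sCK : C \subset K by apply: IHs => //; apply: subset_trans (normal_sub nsTK).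
apply: subset_trans sCCA _; rewrite commGC.
apply: subset_trans (commSg _ sAT) _.
by rewrite commg_subl (subset_trans sCK) ?normal_norm.
Qed.

(** Fixed-point freeness makes the map c |-> [~ c, x] injective on L. *)
Lemma fpf_sub_comm L x : x \in 'N(L) -> 'C_L[x] = 1 -> L \subset [~: L, <[x]>].
Proof.
move=> nCx fpf.
have injf : {in L &, injective (fun c => [~ c, x])}.
  move=> c d Cc Cd /=; rewrite !commgEl => eqcd; apply/esym/eqP.
  rewrite eq_mulgV1 -in_set1 -[[set 1]]fpf inE groupM ?groupV //=.
  apply/cent1P/commgP/conjg_fixP; rewrite conjMg conjVg.
  by apply: (mulgI d^-1); rewrite mulgA -eqcd mulgK mulKg.
have sub : (fun c => [~ c, x]) @: L \subset [~: L, <[x]>].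
  by apply/subsetP=> _ /imsetP[c Cc ->]; rewrite mem_commg ?cycle_id.
have sCA : [~: L, <[x]>] \subset L by rewrite commg_subl cycle_subG.
rewrite -(geq_leqif (subset_leqif_card sCA)).
by rewrite -(card_in_imset injf) subset_leq_card.
Qed.

End Modular.

(** * The hypothesis and its inheritance *)

Definition schmidt_subnormal_or_modular (gT : finGroupType) (G : {group gT}) :=
  forall S : {group gT}, S \subset G -> schmidt_group S ->
    S <|<| G \/ modular_subgroup S G.

Lemma schmidt_subnormal_or_modularS (gT : finGroupType) (G H : {group gT}) :
  H \subset G -> schmidt_subnormal_or_modular G ->
  schmidt_subnormal_or_modular H.
Proof.
move=> sHG hG S sSH scS.
have [subnS | modS] := hG S (subset_trans sSH sHG) scS; [left | right].
  by rewrite -(setIidPl sSH); apply: setI_subnormal subnS.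
exact: modularS modS.
Qed.

(** The subgroup K is a minimal preimage of the Schmidt subgroup Sb: Sb itself
    need not be the image of a Schmidt subgroup of G. *)
Lemma schmidt_subnormal_or_modular_quo (gT : finGroupType) (G N : {group gT}) :
  N <| G -> schmidt_subnormal_or_modular G ->
  schmidt_subnormal_or_modular (G / N)%G.
Proof.
move=> nsNG hG Sb sSG /schmidtP[nnS nilS]; have [sNG nNG] := andP nsNG.
pose gP (K : {group gT}) := (K \subset G) && (K / N == Sb).
have gP0 : gP (coset N @*^-1 Sb)%G.
  by rewrite /gP cosetpreK eqxx andbT sub_cosetpre_quo.
have [K /mingroupP[/andP[sKG /eqP defS] minK] _] := mingroup_exists gP0.
have nNK := subset_trans sKG nNG.
have sKNPhi : K :&: N \subset 'Phi(K).
  apply/bigcapsP=> X; case/predU1P => [->|maxX]; first exact: subsetIl.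
  have [/andP[sXK nsKX] maxXK] := maxgroupP maxX.
  apply: contraR nsKX => nsKNX.
  have nX_KN : X \subset 'N(K :&: N).
    by rewrite normsI ?(subset_trans sXK) ?normG.
  have sK_XN : K \subset N * X.
    have defK : (K :&: N) <*> X :=: K.
      apply/eqP; rewrite eqEsubset join_subG subsetIl sXK /=.
      apply: contraR nsKNX => nsK; rewrite -(maxXK ((K :&: N) <*> X)%G).
      - exact: joing_subl.
      - by rewrite /proper join_subG subsetIl sXK.
      exact: joing_subr.
    by rewrite -{1}defK norm_joinEr // mulSg ?subsetIr.
  rewrite (minK X) // /gP (subset_trans sXK) //= -defS eqEsubset quotientS //=.
  by rewrite quotientSK.
have nnK : ~~ nilpotent K.
  by apply: contra nnS => nilK; rewrite -defS quotient_nil.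
have [T sTK scT] := schmidt_exists nnK.
have [nnT _] := schmidtP _ scT.
(* A normal subgroup L of K containing T and different from K would have a
   proper, hence nilpotent, image in Sb, so it would itself be nilpotent. *)
have closT (L : {group gT}) : L <| K -> T \subset L -> L :=: K.
  move=> nsLK sTL; have [sLK _] := andP nsLK.
  apply: contraNeq nnT => neqLK; apply: nilpotentS sTL _.
  apply: nilpotent_quo_sub_Phi nsLK nNK sKNPhi _; apply: nilS.
  rewrite properEneq -{2}defS quotientS // andbT.
  apply: contra neqLK => /eqP eqLS; rewrite (minK L) // /gP.
  by rewrite (subset_trans sLK) //= eqLS.
have [subT | modT] := hG T (subset_trans sTK sKG) scT; [left | right].
  have subTK : T <|<| K by rewrite -(setIidPl sTK); apply: setI_subnormal subT.
  suff eqTK : T :=: K.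
    by rewrite -[gval Sb]defS -eqTK quotient_subnormal.
  have [//|[L [/subnormal_sub sTL nsLK]]] := subnormalEr subTK.
  by rewrite properE (closT L) ?subxx.
have [L [sTL nsLK] modL] := modular_normal_hull sTK sKG modT.
have -> : Sb = (L / N)%G by apply: val_inj; rewrite /= -[gval Sb]defS (closT L).
exact: quotient_modular.
Qed.

(** The source of all the Schmidt subgroups that are tested below.  A proper
    subgroup U not contained in the abelian subgroup A <*> <[x ^+ r]> has an
    element a * x ^+ i with a in A and x ^+ i a generator of <[x]>; hence
    U :&: A is normalised by x.  By irreducibility U :&: A is trivial and U
    embeds in <[x]>, since the alternative A \subset U would give U all of
    A <*> <[x]>. *)
Lemma schmidt_irreducible_cycle (gT : finGroupType) (A : {group gT}) x r :
    prime r -> r.-elt x -> abelian A -> minnormal A <[x]> ->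
    x \notin 'C(A) -> x ^+ r \in 'C(A) ->
  schmidt_group (A <*> <[x]>).
Proof.
move=> r_pr r_x abA /mingroupP[/andP[ntA nAx] minA] nCx Cxr.
have nAX : <[x]> \subset 'N(A) by [].
have defT : A <*> <[x]> = A * <[x]> by rewrite norm_joinEr.
have sAT : A \subset A <*> <[x]> by apply: joing_subl.
have nsAT : A <| A <*> <[x]> by rewrite /normal sAT join_subG normG.
have splitA (B : {group gT}) :
    B \subset A -> <[x]> \subset 'N(B) -> B :!=: 1 -> B :=: A.
  by move=> sBA nBx ntB; apply: minA => //; rewrite ntB.
apply/schmidtP; split=> [|U prU].
  apply: contra nCx => nilT.
  have := splitA (A :&: 'Z(A <*> <[x]>))%G.
  rewrite subsetIl meet_center_nil //= => defA.
  have sAZ : A \subset 'Z(A <*> <[x]>).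
    apply/setIidPl/defA; rewrite //.
    apply: normsI nAX _.
    exact: subset_trans (joing_subr A _) (normal_norm (center_normal _)).
  rewrite -cycle_subG centsC (subset_trans (subset_trans sAZ (subsetIr _ _))) //.
  by rewrite centS ?joing_subr.
have [sUT nsTU] := andP prU.
pose M := (A <*> <[x ^+ r]>)%G.
have abM : abelian M by rewrite abelianY abA cycle_abelian cycle_subG.
have [sUM | /subsetPn[u Uu nMu]] := boolP (U \subset M).
  exact: nilpotentS sUM (abelian_nil abM).
have : u \in A * <[x]> by rewrite -defT (subsetP sUT).
case/mulsgP=> a _ Aa /cycleP[i ->] def_u.
have gen_xi : generator <[x]> (x ^+ i).
  have [e ox] := p_natP r_x.
  rewrite generator_coprime ox coprimeXl // prime_coprime //.
  apply: contra nMu => /dvdnP[k def_i]; rewrite def_u def_i mulnC expgM.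
  apply: groupM; first exact: subsetP (joing_subl _ _) a Aa.
  by apply: groupX; rewrite -cycle_subG joing_subr.
have defX : <[x]> = <[x ^+ i]> by apply/eqP.
have nUAxi : <[x]> \subset 'N(U :&: A).
  rewrite defX cycle_subG -(mulKg a (x ^+ i)) -def_u groupM ?groupV //.
    have sAN : A \subset 'N(U :&: A).
      apply: cents_norm; apply: subset_trans abA _.
      by rewrite centS ?subsetIr.
    exact: (subsetP sAN).
  have nAU := subset_trans sUT (normal_norm nsAT).
  by rewrite inE conjIg conjGid // (normP _) // (subsetP nAU).
have [UA1 | ntUA] := eqVneq (U :&: A) 1; last first.
  have sAU : A \subset U by rewrite -(splitA (U :&: A)%G) ?subsetIl ?subsetIr.
  case/negP: nsTU; rewrite join_subG sAU defX cycle_subG -(mulKg a (x ^+ i)) -def_u.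
  by rewrite groupM ?groupV ?(subsetP sAU a).
have nAU : U \subset 'N(A) := subset_trans sUT (normal_norm nsAT).
have isoU : U \isog U / A by apply: quotient_isog; rewrite // setIC.
rewrite (isog_nil isoU).
apply: nilpotentS (quotientS A sUT) _.
by rewrite /= defT quotientMidl abelian_nil // quotient_abelian ?cycle_abelian.
Qed.

(** * Simple groups whose proper subgroups are nilpotent *)

Section MinimalNonNilpotentSimple.
Variables (gT : finGroupType) (G : {group gT}).
Hypothesis simG : simple G.
Hypothesis nilG : forall H : {group gT}, H \proper G -> nilpotent H.

Let normalG (H : {group gT}) : H <| G -> H :=: 1 \/ H :=: G.
Proof. by case/simpleP: simG => _; apply. Qed.

(** Take a nontrivial intersection D as large as possible.  Normalisers grow in
    the nilpotent groups M1 and M2, so a maximal subgroup containing 'N_G(D)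
    meets M1 and M2 in more than D and must equal both. *)
Lemma min_nonnilpotent_maximal_TI (M1 M2 : {group gT}) :
  maximal M1 G -> maximal M2 G -> M1 :!=: M2 -> M1 :&: M2 = 1.
Proof.
have [n] := ubnP (#|G| - #|M1 :&: M2|); elim: n => // n IHn in M1 M2 *.
rewrite ltnS => leGn maxM1 maxM2 neqM; apply/eqP; apply: contraT => ntD.
pose D := (M1 :&: M2)%G.
have prM1 := maxgroupp maxM1; have prM2 := maxgroupp maxM2.
have [sM1G _] := andP prM1; have [sM2G _] := andP prM2.
have sDG : D \subset G by rewrite subIset ?sM1G.
have prDM1 : D \proper M1.
  rewrite properE subsetIl subsetI subxx /=; apply: contra neqM => sM12.
  by have [_ max1] := maxgroupP maxM1; rewrite -(max1 M2).
have prDM2 : D \proper M2.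
  rewrite properE subsetIr subsetI subxx andbT /=; apply: contra neqM => sM21.
  by have [_ max2] := maxgroupP maxM2; rewrite -(max2 M1).
have nD1 := nilpotent_proper_norm (nilG prM1) prDM1.
have nD2 := nilpotent_proper_norm (nilG prM2) prDM2.
have prN : 'N_G(D) \proper G.
  rewrite properE subsetIl subsetI subxx /=; apply/negP=> nDG.
  have [D1 | DG] : D :=: 1 \/ D :=: G by apply: normalG; rewrite /normal sDG.
    by rewrite -[M1 :&: M2]/(gval D) D1 eqxx in ntD.
  have := proper_sub prDM1; rewrite DG => sGM1.
  by have := proper_subn prM1; rewrite sGM1.
have [eqN | [M3 maxM3 sN3]] := maximal_exists (proper_sub prN).
  by rewrite eqN properxx in prN.
have step (M : {group gT}) : maximal M G -> D \proper 'N_M(D) -> M3 :=: M.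
  move=> maxM ltD; apply/eqP; apply: contraT => neqM3.
  have sMG : M \subset G by have /andP[] := maxgroupp maxM.
  have ltDI : D \proper M3 :&: M.
    apply: proper_sub_trans ltD _.
    by rewrite subsetI subsetIl andbT (subset_trans _ sN3) ?setSI.
  have I1 : M3 :&: M = 1.
    have sIG := subset_trans (subsetIr M3 M) sMG.
    apply: IHn => //; apply: leq_trans leGn.
    apply: ltn_sub2l; last exact: proper_card.
    exact: leq_trans (proper_card ltDI) (subset_leq_card sIG).
  move: ltDI; rewrite I1 => /proper_card; rewrite cards1 ltnNge.
  by rewrite cardG_gt0.
by case/eqP: neqM; rewrite -(step M1) // -(step M2).
Qed.

(** A maximal subgroup is a Frobenius complement, and the Frobenius kernel
    contradicts simplicity. *)
Lemma simple_min_nonnilpotent_sol : solvable G.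
Proof.
have [eq1G | [M maxM _]] := maximal_exists (sub1G G).
  by rewrite -eq1G solvable1.
have prM := maxgroupp maxM; have [sMG nsGM] := andP prM.
have [_ maxM'] := maxgroupP maxM.
have [M1 | ntM] := eqVneq (gval M) 1.
  have [x Gx nMx] := subsetPn nsGM.
  apply: abelian_sol; suff -> : G :=: <[x]> by apply: cycle_abelian.
  apply/eqP; rewrite eqEsubset cycle_subG Gx andbT.
  apply: contraR nMx => nsGx; rewrite -(maxM' <[x]>%G) ?cycle_id ?M1 ?sub1G //.
  by rewrite /proper cycle_subG Gx.
have nnM : 'N_G(M) = M.
  apply: maxM'; last by rewrite subsetI sMG normG.
  rewrite properE subsetIl subsetI subxx /=; apply/negP=> nMG.
  have [M1 | eqMG] : M :=: 1 \/ M :=: G by apply: normalG; rewrite /normal sMG.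
    by rewrite M1 eqxx in ntM.
  by rewrite eqMG subxx in nsGM.
have frobG : [Frobenius G with complement M].
  apply/andP; split; first by rewrite proper_neq.
  apply/normedTI_P; split.
  - by rewrite setD_eq0 subG1.
  - by rewrite subsetI sMG normD1 normG.
  move=> g Gg; apply: contraR => nMg.
  rewrite -setI_eq0 conjD1g -setDIl min_nonnilpotent_maximal_TI ?setDv //.
    by rewrite -(conjGid Gg) maximalJ.
  apply: contra nMg => /eqP defMg; rewrite -nnM inE Gg; exact/normP/esym.
have [K /andP[/eqP defG _]] := Frobenius_kernel_exists frobG.
have [nsKG _ mulKM _ tiKM] := sdprod_context defG.
have [K1 | KG] := normalG nsKG.
  by rewrite -mulKM K1 mul1g subxx in nsGM.
by rewrite KG (setIidPr sMG) in tiKM; rewrite tiKM eqxx in ntM.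
Qed.
End MinimalNonNilpotentSimple.

(** * Transfer into a Sylow subgroup central in its normaliser *)

Section Burnside.
Variables (gT : finGroupType) (p : nat) (G P : {group gT}).
Hypotheses (sylP : p.-Sylow(G) P) (cNP : 'N_G(P) \subset 'C(P)).

Let sPG : P \subset G := pHall_sub sylP.
Let abP : abelian P.
Proof. by apply: subset_trans cNP; rewrite subsetI sPG normG. Qed.

(** Both P and P :^ x are Sylow subgroups of 'C_G[u ^ x], hence conjugate there;
    so x can be corrected into an element of 'N_G(P), which centralises u. *)
Lemma abelian_Sylow_fusion u x : u \in P -> u ^ x \in P -> x \in G -> u ^ x = u.
Proof.
move=> Pu Pux Gx.
have sPC : P \subset 'C_G[u ^ x].
  by rewrite subsetI sPG sub_cent1 (subsetP abP).
have sPxC : P :^ x \subset 'C_G[u ^ x].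
  rewrite subsetI -{1}(conjGid Gx) conjSg sPG /= sub_cent1 centJ memJ_conjg.
  by rewrite (subsetP abP).
have sylPC : p.-Sylow('C_G[u ^ x]) P := pHall_subl sPC (subsetIl _ _) sylP.
have sylPxC : p.-Sylow('C_G[u ^ x]) (P :^ x).
  apply: pHall_subl sPxC (subsetIl _ _) _.
  by rewrite pHallJ.
have [c /setIP[Gc /cent1P cuc] defPx] := Sylow_trans sylPxC sylPC.
have Nxc : x * c \in 'N_G(P).
  by rewrite inE groupM //= inE conjsgM -defPx.
have /centP/(_ u Pu)/commgP := subsetP cNP _ Nxc.
rewrite commg1_sym => /conjg_fixP; rewrite conjgM.
by move/commute_sym/commgP/conjg_fixP: cuc => ->.
Qed.

(** By the fusion lemma, the transfer from G to P is g |-> g ^+ #|G : P| on P,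
    which is injective there since the index is prime to #|P|. *)
Lemma Burnside_transfer : simple G -> P :!=: 1 -> abelian G.
Proof.
move=> /simpleP[ntG simG] ntP.
have abA : abelian (idm_morphism P @* P) by rewrite morphim_idm.
have Pim u : u \in P -> u \in idm P @* P by rewrite morphim_idm.
pose V := transfer_morphism G abA.
have VP g : g \in P -> V g = FiniteModule.fmod abA (g ^+ #|G : P|).
  move=> Pg; have Gg := subsetP sPG g Pg.
  have [X trX] : exists X, is_transversal X (rcosets P G :* <[g]>) G.
    exists (transversal (rcosets P G :* <[g]>) G).
    exact/transversalP/rcosets_cycle_partition.
  rewrite /V /= (transfer_cycle_expansion sPG abA Gg trX).
  rewrite FiniteModule.fmodX ?Pim // -(sum_index_rcosets_cycle sPG Gg trX).
  rewrite -GRing.sumrMnr; apply: eq_bigr => x Xx.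
  rewrite -FiniteModule.fmodX ?Pim //; congr (FiniteModule.fmod abA _).
  apply: abelian_Sylow_fusion; rewrite ?groupX ?groupV //.
    by rewrite conjgE invgK mulgA -mem_rcoset mulg_exp_card_rcosets.
  by rewrite (subsetP (transversal_sub trX)).
have [kerV|kerV] := simG ('ker V)%G (ker_normal _).
  have injV : 'injm V by apply/trivgP.
  by rewrite -(injm_abelian injV) // finalg.FinRing.Theory.zmod_abelian.
case/eqP: ntP; apply/trivgP/subsetP=> g Pg.
have : g \in 'ker V by rewrite kerV (subsetP sPG).
move/mker; rewrite VP // => /(congr1 (@FiniteModule.fmval _ _ abA)).
rewrite FiniteModule.fmodK ?Pim ?groupX // => gn1.
have coPn : coprime #|P| #|G : P| by case/andP: (pHall_Hall sylP).
by rewrite inE -(expgK coPn Pg) gn1 expg1n.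
Qed.
End Burnside.

(** * Modular subgroups of simple groups *)

Section ModularSimple.
Variable gT : finGroupType.
Implicit Types G H K L M P W Z : {group gT}.

Lemma modular_maximal_cap G M Z W : maximal M G -> modular_subgroup M G ->
  Z \subset G -> M :&: Z \subset W -> W \subset Z -> W :=: M :&: Z \/ W :=: Z.
Proof.
move=> maxM [sMG mod1 _] sZG sMZW sWZ.
have [_ maxM'] := maxgroupP maxM.
have defW : W :=: (W <*> M) :&: Z.
  by rewrite -mod1 //; apply/esym/joing_idPl.
have [eqG | neqG] := eqVneq (W <*> M) G.
  by right; rewrite defW eqG; apply/setIidPr.
left; rewrite defW -[in RHS](maxM' (W <*> M)%G) ?joing_subr //.
by rewrite properEneq neqG join_subG (subset_trans sWZ).
Qed.

Lemma modular_joinJ_max G M : M \proper G -> modular_subgroup M G ->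
  exists L : {group gT}, [/\ M \subset L, L \proper G, modular_subgroup L G &
    forall g, g \in G -> g \notin 'N(L) -> L <*> L :^ g = G].
Proof.
have [n] := ubnP (#|G| - #|M|); elim: n => // n IHn in M *.
rewrite ltnS => leGMn prM modM; have sMG := proper_sub prM.
have [/exists_inP[g Gg /andP[nMg neqG]] | /exists_inPn maxM] :=
  boolP [exists g in G, (g \notin 'N(M)) && (M <*> M :^ g != G)]; last first.
  exists M; split=> // g Gg nMg; apply/eqP.
  by have := maxM g Gg; rewrite nMg /= negbK.
have ltM : M \proper M <*> M :^ g.
  rewrite properE joing_subl join_subG subxx /=.
  by apply: contra nMg => sMgM; rewrite inE.
have prJ : M <*> M :^ g \proper G.
  by rewrite properEneq neqG join_subG sMG -(conjGid Gg) conjSg.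
have [||| L [sML prL modL maxL]] := IHn (M <*> M :^ g)%G => //.
- apply: leq_trans leGMn; apply: ltn_sub2l; last exact: proper_card.
  exact: leq_trans (proper_card ltM) (subset_leq_card (proper_sub prJ)).
- exact: modularY (modularJ Gg modM).
by exists L; split=> //; apply: subset_trans sML; apply: joing_subl.
Qed.

(** With M as given by [modular_joinJ_max], H := 'N_G(M) is the only maximal
    subgroup of G over M, and g outside H gives G = M <*> <[g]> and thus
    H = M <*> (<[g]> :&: H).  If r divides #|H : M|, no r'-element g can lie
    outside H; the subgroup generated by the r'-elements is then proper and
    normal, hence trivial, and G is an r-group. *)
Lemma simple_modular_maximal G M : simple G -> ~~ solvable G ->
  M \proper G -> M :!=: 1 -> modular_subgroup M G ->
  exists2 L : {group gT}, maximal L G & modular_subgroup L G.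
Proof.
move=> /simpleP[_ simG] nsolG prM0 ntM0 modM0.
have {M prM0 ntM0 modM0} [M [ntM prM modM joinM]] :
    exists M : {group gT}, [/\ M :!=: 1, M \proper G, modular_subgroup M G &
      forall g, g \in G -> g \notin 'N(M) -> M <*> M :^ g = G].
  have [L [sML prL modL maxL]] := modular_joinJ_max prM0 modM0.
  exists L; split=> //; apply: contraNneq ntM0 => L1.
  by rewrite -subG1 -L1.
have [sMG nsGM] := andP prM.
pose H := 'N_G(M)%G.
have prH : H \proper G.
  rewrite properE subsetIl subsetI subxx /=; apply/negP=> nMG.
  have [M1 | eqMG] : M :=: 1 \/ M :=: G by apply: simG; rewrite /normal sMG.
    by rewrite M1 eqxx in ntM.
  by rewrite eqMG subxx in nsGM.
have sMH : M \subset H by rewrite subsetI sMG normG.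
have nsMH : M <| H by rewrite /normal sMH subsetIr.
have maxH K : M \subset K -> K \proper G -> K \subset H.
  move=> sMK /andP[sKG nsGK]; apply/subsetP=> k Kk.
  rewrite inE (subsetP sKG) //=; apply: contraR nsGK => nMk.
  rewrite -(joinM k) ?(subsetP sKG) // join_subG sMK.
  by rewrite -(conjGid Kk) conjSg.
have maximalH : maximal H G.
  apply/maxgroupP; split=> // K prK sHK; apply/eqP.
  by rewrite eqEsubset sHK maxH // (subset_trans sMH).
have [eqMH | neqMH] := eqVneq (gval M) H.
  by exists M; rewrite // (group_inj eqMH : M = H).
pose r := pdiv #|H : M|.
have r_pr : prime r.
  rewrite pdiv_prime // indexg_gt1.
  by apply: contra neqMH => sHM; rewrite eqEsubset sMH.
have r'H g : g \in G -> r^'.-elt g -> g \in H.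
  move=> Gg r'g; apply: contraT => nHg.
  have defG : M <*> <[g]> = G.
    apply/eqP; apply: contraR nHg => neqG.
    rewrite -cycle_subG (subset_trans (joing_subr M _)) //.
    rewrite (maxH (M <*> <[g]>)%G) ?joing_subl //.
    by rewrite properEneq neqG join_subG sMG cycle_subG.
  have defH : M <*> (<[g]> :&: H) = H.
    have [_ _ mod2] := modM.
    have sHG := proper_sub prH.
    by rewrite (mod2 _ H) // ?cycle_subG // defG (setIidPr sHG).
  have : r^'.-group (H / M).
    rewrite -defH quotientYidl ?quotient_pgroup //.
      exact: pgroupS (subsetIl _ _) _.
    by rewrite subIset // orbC normal_norm.
  rewrite /pgroup card_quotient ?normal_norm // p'natE //.
  by rewrite pdiv_dvd.
pose K := <<[set g in G | r^'.-elt g]>>%G.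
have sKH : K \subset H.
  by rewrite gen_subG; apply/subsetP=> g; rewrite inE => /andP[]; apply: r'H.
have nsKG : K <| G.
  rewrite /normal (subset_trans sKH) ?(proper_sub prH) //= norms_gen //.
  apply/subsetP=> x Gx; rewrite inE; apply/subsetP=> u /imsetP[g Sg ->{u}].
  by move: Sg; rewrite !inE => /andP[Gg r'g]; rewrite groupJ //= p_eltJ.
have [K1 | KG] := simG K nsKG; last by case/andP: prH => _; rewrite -KG sKH.
case/negP: nsolG; apply: (@pgroup_sol _ r).
apply/pgroupP=> q q_pr q_dv; rewrite inE /=; apply: contraT => neq_qr.
have [x Gx ox] := Cauchy q_pr q_dv.
have : x \in K.
  by rewrite mem_gen // inE Gx /p_elt ox pnatE // !inE.
by rewrite K1 inE -order_eq1 ox => /eqP q1; rewrite q1 in q_pr.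
Qed.

(** Here p is the least prime divisor of #|G| and P a Sylow p-subgroup.  The
    subgroup 'Phi(P) lies in all conjugates of M, so P is elementary abelian.  A
    p'-element y of 'N_G(P) acting nontrivially on P has an irreducible
    submodule P1 without fixed points; a conjugate of M not containing P1 meets
    it trivially, so P1 has order p, but an automorphism of such a group has
    order dividing p.-1, which has no prime factor in common with #|G|. *)
Lemma simple_maximal_modular_sol G M : simple G -> maximal M G ->
  modular_subgroup M G -> solvable G.
Proof.
move=> simG maxM modM; have [ntG normalG] := simpleP _ simG.
have [sMG nsGM] := andP (maxgroupp maxM).
pose p := pdiv #|G|.
have p_pr : prime p by rewrite pdiv_prime // cardG_gt1.
have [P sylP] := Sylow_exists p G.
have [sPG pP _] := and3P sylP.
have ntP : P :!=: 1.
  by rewrite -rank_gt0 (rank_Sylow sylP) p_rank_gt0 mem_primes p_pr cardG_gt0 pdiv_dvd.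
have core1 : gcore M G = 1.
  have [//|coreG] : gcore M G = 1 \/ gcore M G = G.
    by apply: normalG; rewrite /normal gcore_norm (subset_trans (gcore_sub M G)).
  by case/negP: nsGM; rewrite -{1}coreG gcore_sub.
(* No nontrivial subset of G lies in all conjugates of M. *)
have escape (A : {set gT}) :
    (forall x, x \in G -> A \subset M :^ x) -> A \subset [1].
  by move=> sAM; rewrite -core1; apply/bigcapsP.
have maxMx x : x \in G -> maximal (M :^ x)%G G.
  by move=> Gx; rewrite -(conjGid Gx) maximalJ.
have modMx x : x \in G -> modular_subgroup (M :^ x)%G G.
  by move=> Gx; apply: modularJ.
have abP : abelian P.
  apply: (@abelem_abelian _ p); rewrite -(trivg_Phi pP); apply/eqP/trivgP.
  apply: escape => x Gx; have [sPM | nsPM] := boolP (P \subset M :^ x).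
    by apply: subset_trans sPM; apply: Phi_sub.
  apply: subset_trans (subsetIl (M :^ x) P); apply: Phi_sub_max.
  apply/maxgroupP; split=> [|W /andP[sWP nsPW] sIW].
    by rewrite properE subsetIr subsetI (negPf nsPM).
  have [//|eqWP] := modular_maximal_cap (maxMx x Gx) (modMx x Gx) sPG sIW sWP.
  by rewrite eqWP subxx in nsPW.
have cNP : 'N_G(P) \subset 'C(P).
  have nsPN : P <| 'N_G(P) by rewrite /normal subsetI sPG normG subsetIr.
  have sylPN : p.-Sylow('N_G(P)) P := pHall_subl (normal_sub nsPN) (subsetIl _ _) sylP.
  apply/subsetP=> y0 Ny0; rewrite -(consttC p y0) groupM //.
    rewrite (subsetP abP) // (mem_normal_Hall sylPN nsPN) ?p_elt_constt //.
    by rewrite groupX.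
  have: y0.`_p^' \in 'N_G(P) by rewrite groupX.
  have: p^'.-elt y0.`_p^' by apply: p_elt_constt.
  move: y0.`_p^' => {Ny0}y0 p'y /setIP[Gy nPy].
  apply: contraR (ntP) => nCy.
  have nPY : <[y0]> \subset 'N(P) by rewrite cycle_subG.
  have coPY : coprime #|P| #|<[y0]>| by apply: pnat_coprime pP p'y.
  have CR1 := coprime_abel_cent_TI nPY coPY abP.
  have ntR : [~: P, <[y0]>]%G :!=: 1.
    by apply: contra nCy => /eqP/commG1P; rewrite centsC cycle_subG.
  have sRP : [~: P, <[y0]>] \subset P by rewrite commg_subl.
  have [P1 minP1 sP1R] := minnormal_exists ntR (commg_normr <[y0]> P).
  have [/andP[ntP1 nP1Y] minP1'] := mingroupP minP1.
  have sP1P := subset_trans sP1R sRP; have sP1G := subset_trans sP1P sPG.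
  have abP1 : abelian P1 := abelianS sP1P abP.
  have /exists_inP[x Gx nsP1M] : [exists x in G, ~~ (P1 \subset M :^ x)].
    apply: contraR ntP1; rewrite negb_exists_in => /forall_inP sP1M.
    by rewrite -subG1; apply: escape => x Gx; have := sP1M x Gx; rewrite negbK.
  have TI1 : M :^ x :&: P1 = 1.
    have nP1K : P1 <*> <[y0]> \subset 'N(P1) by rewrite join_subG normG.
    pose B := (M :^ x :&: (P1 <*> <[y0]>))%G.
    have sKG : P1 <*> <[y0]> \subset G by rewrite join_subG sP1G cycle_subG.
    have nBP1 : P1 \subset 'N(M :^ x :&: P1).
      by apply: sub_abelian_norm; rewrite ?subsetIr.
    have defK : P1 * B = P1 <*> <[y0]>.
      rewrite -norm_joinEr ?(subset_trans (subsetIr _ _)) //.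
      have [||eqB|//] := modular_maximal_cap (W := (P1 <*> B)%G) (maxMx x Gx) (modMx x Gx) sKG.
      - exact: joing_subr.
      - by rewrite join_subG joing_subl subsetIr.
      case/negP: nsP1M; apply: subset_trans (joing_subl P1 B) _.
      by rewrite eqB subsetIl.
    have : y0 \in P1 * B by rewrite defK -cycle_subG joing_subr.
    case/mulsgP=> a b P1a /setIP[Mb Kb] def_y.
    have nIy : <[y0]> \subset 'N(M :^ x :&: P1).
      rewrite cycle_subG def_y groupM ?(subsetP nBP1 a) //.
      rewrite (subsetP (normsI _ _) b (cycle_id b)) // cycle_subG.
        by rewrite (subsetP (normG _)).
      exact: subsetP nP1K b Kb.
    apply/eqP; apply: contraR nsP1M => ntI.
    by rewrite -(minP1' (M :^ x :&: P1)%G) ?ntI ?subsetIl ?subsetIr.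
  have oP1 : #|P1| = p.
    have [z P1z oz] : {z | z \in P1 & #[z] = p}.
      apply: Cauchy => //.
      by have [|_ ->] := pgroup_pdiv (pgroupS sP1P pP).
    have [] := @modular_maximal_cap _ _ P1 <[z]>%G (maxMx x Gx) (modMx x Gx) sP1G.
    - by rewrite TI1 sub1G.
    - by rewrite cycle_subG.
    - by rewrite /= TI1 => z1; rewrite -oz orderE z1 cards1 in p_pr.
    by move=> <-; rewrite -orderE.
  case/negP: ntP1; rewrite -subG1 -CR1 subsetI sP1R /=.
  rewrite centsC cycle_subG.
  suff: y0 \in 'ker (conj_aut P1) by rewrite ker_conj_aut.
  have Ny1 : y0 \in 'N(P1) by rewrite -cycle_subG.
  apply/kerP; rewrite //=; apply/eqP; rewrite -order_eq1; apply: contraT => neq1.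
  pose r := pdiv #[conj_aut P1 y0].
  have r_pr : prime r by rewrite pdiv_prime // ltn_neqAle eq_sym neq1 order_gt0.
  have r_dvd : r %| #[y0].
    apply: dvdn_trans (pdiv_dvd _) _.
    exact: (morph_order (conj_aut_morphism P1)).
  have le_pr : p <= r.
    apply: pdiv_min_dvd; first exact: prime_gt1.
    exact: dvdn_trans r_dvd (order_dvdG Gy).
  have : r %| #|Aut P1|.
    apply: dvdn_trans (pdiv_dvd _) (order_dvdG _).
    by apply: subsetP (Aut_conj_aut P1 'N(P1)) _ _; rewrite mem_morphim.
  rewrite card_Aut_cyclic ?prime_cyclic ?oP1 // totient_prime //.
  move/dvdn_leq; rewrite -subn1 subn_gt0 prime_gt1 // => /(_ isT).
  by rewrite leqNgt ltn_subLR ?prime_gt0 // add1n ltnS le_pr.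
exact: abelian_sol (Burnside_transfer sylP cNP simG ntP).
Qed.
End ModularSimple.

(** * Solvability *)

Lemma schmidt_subnormal_or_modular_sol (gT : finGroupType) (G : {group gT}) :
  schmidt_subnormal_or_modular G -> solvable G.
Proof.
have [n] := ubnP #|G|; elim: n => // n IHn in gT G *; rewrite ltnS => leGn hG.
have [-> | ntG] := eqVneq G 1%G; first exact: solvable1.
have [simG | nsimG] := boolP (simple G); last first.
  have [N minN sNG] := minnormal_exists ntG (normG G).
  have [/andP[ntN nNG] _] := mingroupP minN.
  have nsNG : N <| G by rewrite /normal sNG.
  have prN : N \proper G.
    rewrite properEneq sNG andbT; apply: contra nsimG => /eqP eqNG.
    by rewrite /simple -{1}eqNG.
  rewrite (series_sol nsNG) !IHn //.
  - exact: leq_trans (ltn_quotient ntN sNG) leGn.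
  - exact: schmidt_subnormal_or_modular_quo.
  - exact: leq_trans (proper_card prN) leGn.
  - exact: schmidt_subnormal_or_modularS hG.
apply: contraT => nsolG.
have nnG : ~~ nilpotent G by apply: contra nsolG; apply: nilpotent_sol.
have [T sTG scT] := schmidt_exists nnG.
have [nnT nilT] := schmidtP _ scT.
have [eqTG | neqTG] := eqVneq T G.
  rewrite -eqTG in nsolG; case/negP: nsolG.
  by apply: simple_min_nonnilpotent_sol; rewrite // eqTG.
have prT : T \proper G.
  by rewrite properEneq sTG andbT; apply: contra neqTG => /eqP/group_inj->.
have [subT | modT] := hG T sTG scT.
  have [eqTG | [K [/subnormal_sub sTK nsKG prK]]] := subnormalEr subT.
    by rewrite eqTG properxx in prT.
  have [_ /(_ K nsKG)[K1 | eqKG]] := simpleP _ simG.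
    by rewrite (trivgP (subset_trans sTK _)) ?K1 // nilpotent1 in nnT.
  by rewrite eqKG properxx in prK.
have ntT : T :!=: 1 by apply: contraNneq nnT => ->; apply: nilpotent1.
have [L maxL modL] := simple_modular_maximal simG nsolG prT ntT modT.
by rewrite (simple_maximal_modular_sol simG maxL modL) in nsolG.
Qed.

(** * Irreducible actions of a single element *)

Section IrreducibleAction.
Variable gT : finGroupType.
Implicit Types D H K M N : {group gT}.

Lemma minnormalP N (A : {set gT}) : reflect
  [/\ N :!=: 1, A \subset 'N(N) &
      forall K, K :!=: 1 -> A \subset 'N(K) -> K \subset N -> K :=: N]
  (minnormal N A).
Proof.
apply: (iffP mingroupP) => [[/andP[ntN nNA] minN] | [ntN nNA minN]].
  by split=> // K ntK nKA; apply: minN; rewrite ntK.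
by split=> [|K /andP[ntK nKA]]; [rewrite ntN | apply: minN].
Qed.

Lemma minnormal_fpf N x : minnormal N <[x]> -> x \notin 'C(N) -> 'C_N[x] = 1.
Proof.
move=> /minnormalP[ntN nNx minN]; apply: contraNeq => ntC.
have nCx : <[x]> \subset 'N('C[x]) by rewrite -cent_cycle norms_cent ?normG.
rewrite -cycle_subG centsC cent_cycle; apply/setIidPl/minN; rewrite ?subsetIl //.
by apply: normsI => //; apply: nCx.
Qed.

Lemma irreducible_faithful_abelian_cyclic p N H :
  p.-abelem N -> minnormal N H -> 'C_H(N) = 1 -> abelian H -> cyclic H.
Proof.
move=> abelN minN cHN abH; have [ntN nNH _] := minnormalP _ _ minN.
have irr := elimT (abelem_mx_irrP abelN ntN nNH) minN.
exact: mx_faithful_irr_abelian_cyclic (abelem_mx_faithful _ _ _ cHN) irr abH.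
Qed.

(** Schur's lemma and the commutativity of the ring generated by y, without
    rings.  For c in D and a nontrivial n0 in N, the image n0 ^ c is a product
    theta s n0 of conjugates of n0 by powers of y.  The maps c and theta s
    commute with y and agree at n0, so they agree on N; and theta s commutes
    with every d in D. *)
Lemma irreducible_cent_abelian N D y : abelian N -> minnormal N <[y]> ->
  D \subset 'C[y] -> D \subset 'N(N) -> 'C_D(N) = 1 -> abelian D.
Proof.
move=> abN /minnormalP[ntN nNy minN] cDy nND cDN.
have [n0 Nn0 nt0] : exists2 n0, n0 \in N & n0 != 1.
  exact/trivgPn.
have min1 K : K \subset N -> <[y]> \subset 'N(K) -> n0 \in K -> K :=: N.
  move=> sKN nKy Kn0; apply: minN => //; apply: contraNneq nt0 => K1.
  by rewrite -in_set1 -[[set 1]]K1.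
pose theta (s : seq gT) n := \prod_(h <- s) n ^ h.
have thetaN s n : all (mem <[y]>) s -> n \in N -> theta s n \in N.
  move=> /allP sy Nn; rewrite /theta big_seq; apply: group_prod => h /sy yh.
  by rewrite memJ_norm // (subsetP nNy).
have thetaM s : all (mem <[y]>) s -> {in N &, {morph theta s : m n / m * n}}.
  elim: s => [|h s IHs] /= => [_ m n _ _|/andP[yh sy] m n Nm Nn].
    by rewrite /theta !big_nil mulg1.
  rewrite /theta !big_cons -![\prod_(h <- s) _]/(theta s _) IHs // conjMg.
  have Nnh : n ^ h \in N by rewrite memJ_norm // (subsetP nNy).
  have := centsP abN _ Nnh _ (thetaN s m sy Nm).
  move: (m ^ h) (n ^ h) (theta s m) (theta s n) => a b c d cbc.
  by rewrite -(mulgA a) (mulgA b) cbc !mulgA.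
have thetaJ s n d :
    all (mem <[y]>) s -> d \in 'C[y] -> theta s n ^ d = theta s (n ^ d).
  move=> + cyd; rewrite /theta; elim: s => [|h s IHs] /=.
    by rewrite !big_nil conj1g.
  case/andP=> yh /IHs{}IHs; rewrite !big_cons conjMg IHs -!conjgM.
  have /centP/(_ h yh) -> : d \in 'C(<[y]>) by rewrite cent_cycle.
  by [].
have gen0 n : n \in N -> exists2 s, all (mem <[y]>) s & n = theta s n0.
  have <- : <<n0 ^: <[y]> >> = N.
    apply: (min1 <<_>>%G) => /=.
    - by rewrite gen_subG class_sub_norm.
    - by rewrite norms_gen // class_norm.
    by rewrite mem_gen // class_refl.
  case/gen_prodgP=> k [c Ac ->].
  pose spanned n := exists2 s, all (mem <[y]>) s & n = theta s n0.
  apply: (big_ind spanned) => [|_ _ [s sy ->] [t ty ->]|i _].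
  - by exists [::]; rewrite // /theta big_nil.
  - by exists (s ++ t); rewrite ?all_cat ?sy // /theta big_cat.
  by have /imsetP[h yh ->] := Ac i; exists [:: h]; rewrite /= ?yh // /theta big_seq1.
apply/centsP=> c Dc d Dd; apply/commgP.
rewrite -in_set1 -[[set 1]]cDN inE groupR //=; apply/centP=> n Nn.
apply/esym/commgP/conjg_fixP.
have [s sy def0] : exists2 s, all (mem <[y]>) s & n0 ^ c = theta s n0.
  by apply: gen0; rewrite memJ_norm // (subsetP nND).
pose E := [set m in N | m ^ c == theta s m].
have gE : group_set E.
  apply/group_setP; split=> [|m m'].
    by rewrite inE group1 conj1g /theta big1 //= => h; rewrite conj1g.
  rewrite !inE => /andP[Nm /eqP eqm] /andP[Nm' /eqP eqm'].
  by rewrite groupM //= thetaM // conjMg eqm eqm'.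
have sEN : E \subset N by apply/subsetP=> m; rewrite inE => /andP[].
have defE : Group gE :=: N.
  apply: min1 => //; last by rewrite inE Nn0 /= def0.
  rewrite cycle_subG inE; apply/subsetP=> _ /imsetP[m Em ->]; move: Em.
  have cyy : y \in 'C[y] by apply/cent1P.
  have cyc : commute y c by apply/cent1P; rewrite cent1C (subsetP cDy).
  rewrite !inE => /andP[Nm /eqP eqm].
  rewrite memJ_norm ?(subsetP nNy) ?cycle_id //=.
  by rewrite Nm -(thetaJ _ m y) // -eqm -(conjgM m y c) cyc conjgM eqxx.
have defc m : m \in N -> m ^ c = theta s m.
  by rewrite -{1}defE inE => /andP[_ /eqP].
have nJcd m : m \in N -> m ^ (d * c) = m ^ (c * d).
  move=> Nm; have Nmd : m ^ d \in N by rewrite memJ_norm // (subsetP nND).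
  by rewrite !conjgM !defc // thetaJ // (subsetP cDy).
have -> : [~ c, d] = (d * c)^-1 * (c * d) by rewrite commgEl conjgE invMg !mulgA.
rewrite conjgM -nJcd ?conjgKV // memJ_norm //.
by rewrite groupV groupM ?(subsetP nND).
Qed.
End IrreducibleAction.

(** * A faithful irreducible complement *)

Section PrimitiveCase.
Variables (gT : finGroupType) (p : nat) (G N H : {group gT}).
Hypotheses (hG : schmidt_subnormal_or_modular G) (abelN : p.-abelem N).
Hypotheses (minN : minnormal N G) (defG : N ><| H = G) (cHN : 'C_H(N) = 1).

Let pN : p.-group N := abelem_pgroup abelN.
Let abN : abelian N := abelem_abelian abelN.
Let nsNG : N <| G. Proof. by case/sdprod_context: defG. Qed.
Let sNG : N \subset G := normal_sub nsNG.
Let sHG : H \subset G. Proof. by case/sdprod_context: defG. Qed.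
Let nNH : H \subset 'N(N). Proof. by case/sdprod_context: defG. Qed.
Let tiNH : N :&: H = 1. Proof. by case/sdprod_context: defG. Qed.

Lemma minnormal_compl : minnormal N H.
Proof.
have [ntN _ minN'] := minnormalP _ _ minN.
apply/minnormalP; split=> // K ntK nKH sKN; apply: minN' => //.
have [_ _ <- _ _] := sdprod_context defG.
by rewrite mul_subG // sub_abelian_norm.
Qed.

Lemma joing_cycle_capN (K : {group gT}) y :
    K \subset N -> y \in H -> y \in 'N(K) ->
  (K <*> <[y]>) :&: N = K.
Proof.
move=> sKN Hy nKy; rewrite norm_joinEr ?cycle_subG // -group_modl //.
have -> : <[y]> :&: N = 1 by apply/trivgP; rewrite /= setIC -tiNH setIS ?cycle_subG.
exact: mulg1.
Qed.

Lemma joing_cycle_capH (K : {group gT}) y :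
    K \subset N -> y \in H -> y \in 'N(K) ->
  (K <*> <[y]>) :&: H = <[y]>.
Proof.
move=> sKN Hy nKy; rewrite norm_joinEr ?cycle_subG //.
rewrite setIC -group_modr ?cycle_subG //.
have -> : H :&: K = 1 by apply/trivgP; rewrite /= setIC -tiNH setSI.
exact: mul1g.
Qed.

Lemma notin_centN y : y \in H -> y != 1 -> y \notin 'C(N).
Proof.
move=> Hy; apply: contra => cNy.
by rewrite -in_set1 -[[set 1]]cHN inE Hy.
Qed.

(** Take N0 irreducible in [~: N, <[y]>] and the Schmidt subgroup
    T = N0 <*> <[y]>.  If T is subnormal, it contains [~: N, <[y]>].  If T is
    modular, every h in H normalises N0: the join V of T and N0 :^ h lies in
    T <*> <[h]>, so by modularity V is generated by T and by <[h]> :&: V, which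
    lies in H :&: (N <*> <[y]>) = <[y]>; thus V = T, and N0 = N. *)
Lemma commg_prime_minnormal q y : prime q -> q != p -> y \in H -> #[y] = q ->
  minnormal [~: N, <[y]>] <[y]>.
Proof.
move=> q_pr neq_qp Hy oy.
have nt_y : y != 1 by rewrite -order_gt1 oy prime_gt1.
have Gy := subsetP sHG y Hy; have nNy := subsetP nNH y Hy.
have nNY : <[y]> \subset 'N(N) by rewrite cycle_subG.
have coNy : coprime #|N| #|<[y]>|.
  apply: pnat_coprime pN _; rewrite -orderE oy pnatE // !inE.
pose M := [~: N, <[y]>]%G.
have CM1 : 'C_M[y] = 1.
  by rewrite -cent_cycle; apply: coprime_abel_cent_TI.
have sMN : M \subset N by rewrite commg_subl.
have nMy : <[y]> \subset 'N(M) by apply: commg_normr.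
have ntM : M :!=: 1.
  apply: contra (notin_centN Hy nt_y) => /eqP/commG1P.
  by rewrite centsC cycle_subG.
have [N0 minN0 sN0M] := minnormal_exists ntM nMy.
have [ntN0 nN0y minN0'] := minnormalP _ _ minN0.
suff <- : N0 :=: M by [].
have sN0N := subset_trans sN0M sMN.
pose T := (N0 <*> <[y]>)%G.
have capTN : T :&: N = N0 by apply: joing_cycle_capN; rewrite // -cycle_subG.
have capTH : T :&: H = <[y]> by apply: joing_cycle_capH; rewrite // -cycle_subG.
have sTG : T \subset G by rewrite join_subG (subset_trans sN0N) ?cycle_subG.
have scT : schmidt_group T.
  apply: (schmidt_irreducible_cycle q_pr) minN0 _ _.
  - by rewrite /p_elt oy pnat_id.
  - exact: abelianS sN0N abN.
  - apply: contra ntN0 => cN0y; rewrite -subG1 -CM1 subsetI sN0M.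
    by rewrite -cent_cycle centsC cycle_subG.
  by rewrite -oy expg_order group1.
have [subT | [_ _ modT]] := hG sTG scT.
  apply/eqP; rewrite eqEsubset sN0M -capTN subsetI sMN andbT.
  apply: (subnormal_comm_sub (A := <[y]>%G) subT) (subset_trans sMN sNG) _ _.
    exact: joing_subr.
  by apply: fpf_sub_comm => //; rewrite -cycle_subG.
suff eqN0N : N0 :=: N.
  by apply/eqP; rewrite eqEsubset sN0M eqN0N.
have [_ _ minNH] := minnormalP _ _ minnormal_compl.
apply: minNH => //; apply/subsetP=> h Hh; rewrite inE.
have sN0hN : N0 :^ h \subset N by rewrite -(normP (subsetP nNH h Hh)) conjSg.
pose V := (T <*> N0 :^ h)%G.
have Gh := subsetP sHG h Hh.
have sVG : V \subset G by rewrite join_subG sTG (subset_trans sN0hN).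
have defV : T <*> (<[h]> :&: V) = V.
  rewrite (modT <[h]>%G V) ?cycle_subG ?joing_subl //; apply/setIidPr.
  have sNTh : N0 :^ h \subset T <*> <[h]>.
    have sMh : h \in T <*> <[h]> by rewrite -cycle_subG joing_subr.
    rewrite -(conjGid sMh) conjSg.
    by apply: subset_trans (joing_subl _ _); apply: joing_subl.
  by rewrite join_subG joing_subl.
have sVT : V \subset T.
  rewrite -defV join_subG subxx /=.
  have sVNy : V \subset N <*> <[y]>.
    by rewrite !join_subG joing_subr !(subset_trans _ (joing_subl _ _)).
  have capNH : H :&: (N <*> <[y]>) = <[y]> by rewrite setIC joing_cycle_capH.
  have : <[h]> :&: V \subset H :&: (N <*> <[y]>).
    rewrite subsetI (subset_trans (subsetIr _ _) sVNy) andbT.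
    by apply: subset_trans (subsetIl _ _) _; rewrite cycle_subG.
  by rewrite capNH => /subset_trans -> //; apply: joing_subr.
have : N0 :^ h \subset T :&: N.
  by rewrite subsetI sN0hN andbT (subset_trans _ sVT) ?joing_subr.
by rewrite capTN.
Qed.

(** Otherwise y and some conjugate of it, which commute, have distinct
    irreducible commutators in N, and these meet trivially. *)
Lemma central_prime_irreducible q y : prime q -> q != p -> y \in 'Z('O_q(H)) ->
  #[y] = q -> minnormal N <[y]>.
Proof.
move=> q_pr neq_qp Zy oy.
have sZH : 'Z('O_q(H)) \subset H by apply: subset_trans (center_sub _) (pcore_sub _ _).
have Hy := subsetP sZH y Zy.
have nZH : H \subset 'N('Z('O_q(H))).
  by rewrite normal_norm // (char_normal_trans (center_char _) (pcore_normal _ _)).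
have fpfM x : x \in H -> #[x] = q -> 'C_[~: N, <[x]>][x] = 1.
  move=> Hx ox; rewrite -cent_cycle; apply: coprime_abel_cent_TI => //.
    by rewrite cycle_subG (subsetP nNH).
  by apply: pnat_coprime pN _; rewrite -orderE ox pnatE // !inE.
pose M := [~: N, <[y]>]%G.
have minM : minnormal M <[y]> := commg_prime_minnormal q_pr neq_qp Hy oy.
(* y2 centralises the commutator of y1, so y1 * y2 acts on it as y1 does; by
   irreducibility it exhausts the commutator of y1 * y2. *)
have absorb y1 y2 : y1 \in H -> y2 \in H -> #[y1] = q -> #[y2] = q ->
    commute y1 y2 -> [~: N, <[y1]>] :&: [~: N, <[y2]>] = 1 ->
    [~: N, <[y1]>] = [~: N, <[y1 * y2]>].
  move=> Hy1 Hy2 oy1 oy2 cy12 tiM; set w := y1 * y2.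
  have Hw : w \in H by rewrite groupM.
  pose M1 := [~: N, <[y1]>]%G.
  have minM1 : minnormal M1 <[y1]> := commg_prime_minnormal q_pr neq_qp Hy1 oy1.
  have [ntM1 nM1y1 _] := minnormalP _ _ minM1.
  have sM1N : M1 \subset N by rewrite commg_subl cycle_subG (subsetP nNH).
  have nM1y2 : <[y2]> \subset 'N(M1).
    rewrite normsR ?cycle_subG ?(subsetP nNH) //.
    by rewrite (subsetP (cent_sub _)) // cent_cycle; apply/cent1P.
  have cM1y2 : y2 \in 'C(M1).
    rewrite -cycle_subG centsC; apply/commG1P/trivgP; rewrite -tiM subsetI.
    by rewrite commg_subl nM1y2 commSg.
  have fpfw : 'C_M1[w] = 1.
    apply/trivgP; rewrite -(fpfM y1 Hy1 oy1) subsetI subsetIl /=.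
    apply/subsetP=> c /setIP[Mc /cent1P cwc]; apply/cent1P.
    have cy2c : commute y2 c by apply: (centP cM1y2).
    have -> : y1 = w * y2^-1 by rewrite mulgK.
    by apply: commuteM => //; apply/commuteV/commute_sym.
  have nt_w : w != 1.
    apply: contraNneq ntM1 => w1; rewrite -subG1 -fpfw w1 subsetI subxx /=.
    by apply/subsetP=> c _; apply/cent1P/commute1.
  have ow : #[w] = q.
    apply: (prime_nt_dvdP q_pr); first by rewrite order_eq1.
    by rewrite order_dvdn expgMn // -{1}oy1 -oy2 !expg_order mulg1.
  have [_ _ minMw] := minnormalP _ _ (commg_prime_minnormal q_pr neq_qp Hw ow).
  have nM1w : w \in 'N(M1) by rewrite groupM // -cycle_subG.
  apply: (minMw M1) => //; first by rewrite cycle_subG.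
  by apply: subset_trans (fpf_sub_comm nM1w fpfw) _; rewrite commSg.
suff nMH : H \subset 'N(M).
  have [ntM _ _] := minnormalP _ _ minM.
  have [_ _ minNH] := minnormalP _ _ minnormal_compl.
  rewrite -(minNH M) //.
  by rewrite commg_subl cycle_subG (subsetP nNH).
apply/normsP=> h Hh.
have Hyh : y ^ h \in H by rewrite groupJ.
have defMh : M :^ h = [~: N, <[y ^ h]>].
  by rewrite conjsRg cycleJ (normP (subsetP nNH h Hh)).
have Zyh : y ^ h \in 'Z('O_q(H)) by rewrite memJ_norm // (subsetP nZH).
have cyyh : commute y (y ^ h).
  by apply: (centsP (center_abelian _)) Zy _ Zyh.
have oyh : #[y ^ h] = q by rewrite orderJ.
have [ntM nMy minM'] := minnormalP _ _ minM.
have nMhy : <[y]> \subset 'N(M :^ h).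
  rewrite defMh normsR ?cycle_subG ?(subsetP nNH) //.
  by rewrite (subsetP (cent_sub _)) // cent_cycle; apply/cent1P.
have [tiM | ntI] := eqVneq (M :&: M :^ h) 1.
  rewrite defMh in tiM; rewrite defMh -[RHS]/([~: N, <[y]>]).
  by rewrite (absorb y (y ^ h)) // (absorb (y ^ h) y) // 1?setIC // cyyh.
apply/eqP; rewrite eq_sym eqEcard cardJg leqnn andbT.
have eqI : M :&: M :^ h = M by apply: (minM' (M :&: M :^ h)%G); rewrite ?normsI ?subsetIl.
by apply/setIidPl.
Qed.

(** For y as in the previous lemma, D := 'C_H[y] is cyclic, being abelian,
    faithful and irreducible on N, and it contains 'O_q(H), so <[y]> is normal
    in H.  If D is not H, an element x of H outside D of
    least order has r-power order with x ^+ r in D, and S := <[y]> <*> <[x]> is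
    a Schmidt subgroup of H.  If S were subnormal it would contain
    N = [~: N, <[y]>].  If S is modular, then for n in N the join <[n]> <*> S
    contains N, and S :&: N = 1 forces N = <[n]>; then H, which embeds in the
    abelian group Aut N, centralises y. *)
Lemma primitive_compl_cyclic : solvable H -> 'O_p(H) = 1 -> cyclic H.
Proof.
move=> solH Op1; have [-> | ntH] := eqVneq (gval H) 1; first exact: cyclic1.
have [ntN _ _] := minnormalP _ _ minN.
have ntF : 'F(H) != 1 by rewrite trivg_Fitting.
pose q := pdiv #|'F(H)|.
have q_pr : prime q by rewrite pdiv_prime // cardG_gt1.
pose Q := 'O_q(H)%G.
have ntQ : Q :!=: 1.
  rewrite /= -p_core_Fitting -rank_gt0.
  rewrite (rank_Sylow (nilpotent_pcore_Hall q (Fitting_nil H))) p_rank_gt0.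
  by rewrite mem_primes q_pr cardG_gt0 pdiv_dvd.
have neq_qp : q != p by apply: contra ntQ => /eqP eq_qp; rewrite /= eq_qp Op1.
have qQ : q.-group Q by apply: pcore_pgroup.
have ntZ : 'Z(Q) != 1.
  by apply: contraNneq ntQ => /(trivg_center_pgroup qQ) ->.
have [y Zy oy] : {y | y \in 'Z(Q) & #[y] = q}.
  apply: Cauchy => //.
  by have [|_ ->] := pgroup_pdiv (pgroupS (center_sub Q) qQ).
have minNy := central_prime_irreducible q_pr neq_qp Zy oy.
have nt_y : y != 1 by rewrite -order_gt1 oy prime_gt1.
have sQH : Q \subset H := pcore_sub q H.
have Qy : y \in Q by apply: subsetP (center_sub Q) y Zy.
have Hy : y \in H := subsetP sQH y Qy.
have ncy := notin_centN Hy nt_y.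
pose D := 'C_H[y]%G.
have sDH : D \subset H := subsetIl H _.
have cDN : 'C_D(N) = 1 by apply/trivgP; rewrite -cHN setSI.
have nDN := subset_trans sDH nNH.
have abD : abelian D.
  apply: irreducible_cent_abelian abN minNy _ nDN cDN; exact: subsetIr.
have cycD : cyclic D.
  apply: irreducible_faithful_abelian_cyclic abelN _ cDN abD.
  have [_ _ minN'] := minnormalP _ _ minNy.
  apply/minnormalP; split=> // K ntK nKD; apply: minN' => //.
  apply: subset_trans nKD; rewrite cycle_subG inE Hy; exact/cent1P.
have [eqDH | neqDH] := eqVneq (gval D) H; first by rewrite -eqDH.
have sQD : Q \subset D.
  rewrite subsetI sQH /= -cent_cycle centsC cycle_subG.
  by case/setIP: Zy.
have nYH : H \subset 'N(<[y]>).
  apply/normsP=> h Hh; apply/eqP.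
  have sYQ : <[y]> \subset Q by rewrite cycle_subG.
  have sYhQ : <[y]> :^ h \subset Q.
    have nQH : H \subset 'N(Q) := normal_norm (pcore_normal q H).
    by rewrite -[gval Q](normP (subsetP nQH h Hh)) conjSg.
  by rewrite (eq_subG_cyclic (cyclicS sQD cycD) sYhQ sYQ) cardJg.
have [x0 Hx0 nDx0] : exists2 x, x \in H & x \notin D.
  by apply/subsetPn; apply: contra neqDH => sHD; rewrite eqEsubset sDH.
pose HD x := (x \in H) && (x \notin D).
have HDx0 : HD x0 by rewrite /HD Hx0.
case: (@arg_minnP gT x0 HD (fun x => #[x]) HDx0) => x /andP[Hx nDx] minx.
have inD z : z \in H -> #[z] < #[x] -> z \in D.
  move=> Hz; rewrite ltnNge; apply: contraR => nDz.
  by apply: minx; rewrite /HD Hz.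
have nt_x : 1 < #[x] by rewrite order_gt1; apply: contraNneq nDx => ->.
pose r := pdiv #[x].
have r_pr : prime r by apply: pdiv_prime.
have r_dv : r %| #[x] := pdiv_dvd _.
have r_x : r.-elt x.
  apply: contraR nDx => nr_x; rewrite -(consttC r x).
  (* Otherwise both the r-part and the r'-part of x have smaller order. *)
  have [lt1 lt2] : 1 < #[x]`_r /\ 1 < #[x]`_r^'.
    rewrite p_part_gt1 mem_primes r_pr order_gt0 r_dv; split=> //.
    by rewrite ltn_neqAle part_gt0 andbT eq_sym partn_eq1 ?order_gt0 // pnatNK.
  rewrite groupM // inD ?groupX // order_constt -[X in _ < X](partnC r (order_gt0 x)).
    by rewrite ltn_Pmulr ?part_gt0.
  by rewrite ltn_Pmull ?part_gt0.
have Dxr : x ^+ r \in D.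
  apply: inD; first exact: groupX.
  by rewrite orderXdiv // ltn_Pdiv ?prime_gt1.
pose S := (<[y]> <*> <[x]>)%G.
have sSH : S \subset H by rewrite join_subG !cycle_subG Hy.
have scS : schmidt_group S.
  apply: (schmidt_irreducible_cycle r_pr r_x) (cycle_abelian y) _ _ _.
  - apply/minnormalP; split; rewrite ?cycle_eq1 ?cycle_subG ?(subsetP nYH) //.
    move=> K ntK _ sKy; apply/eqP; rewrite eqEcard sKy /= -orderE oy.
    by rewrite (prime_nt_dvdP q_pr _ (_ : #|K| %| q)) -?trivg_card1 // -oy cardSg.
  - by apply: contra nDx; rewrite inE Hx cent_cycle.
  by case/setIP: Dxr => _; rewrite cent_cycle.
have fpfy : 'C_N[y] = 1 := minnormal_fpf minNy ncy.
have [subS | [_ modS _]] := hG (subset_trans sSH sHG) scS.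
  have /negP[] := ntN; rewrite -subG1 -tiNH subsetI subxx /=.
  apply: subset_trans sSH; apply: (subnormal_comm_sub (A := <[y]>%G) subS) sNG _ _.
    exact: joing_subl.
  by apply: fpf_sub_comm => //; rewrite (subsetP nNH).
have [n Nn nt_n] := trivgPn _ ntN.
pose V := (<[n]> <*> S)%G.
have sNV : N \subset V.
  have [_ _ minN'] := minnormalP _ _ minNy.
  apply/setIidPl/(minN' (N :&: V)%G); rewrite ?subsetIl //=.
    apply/trivgPn; exists n; rewrite // inE Nn -cycle_subG joing_subl //.
  rewrite normsI ?cycle_subG ?(subsetP nNH) // (subsetP (normG _)) //.
  by rewrite -cycle_subG (subset_trans (joing_subl _ <[x]>)) ?joing_subr.
have defN : N :=: <[n]>.
  have := modS <[n]>%G N; rewrite cycle_subG => /(_ Nn sNG) /=.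
  rewrite (setIidPr sNV) => <-.
  have -> : S :&: N = 1 by apply/trivgP; rewrite /= setIC -tiNH setIS.
  by rewrite joingG1.
have abH : abelian H.
  have abA : abelian (Aut N) by apply: Aut_cyclic_abelian; rewrite defN cycle_cyclic.
  have AutN h : h \in H -> conj_aut N h \in Aut N.
    move=> Hh; apply: subsetP (Aut_conj_aut N 'N(N)) _ _.
    by rewrite mem_morphim ?(subsetP nNH).
  apply/centsP=> a Ha b Hb; apply/commgP; rewrite -in_set1 -[[set 1]]cHN.
  rewrite inE groupR //= -(ker_conj_aut N); apply/kerP.
    by rewrite groupR ?(subsetP nNH).
  rewrite morphR ?(subsetP nNH) //; apply/eqP/commgP.
  by apply: (centsP abA); apply: AutN.
case/negP: nDx; rewrite inE Hx; apply/cent1P; exact: (centsP abH).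
Qed.
End PrimitiveCase.

(** * Lifting from quotients *)

Lemma cyclic_quo_Fitting (gT : finGroupType) (G L : {group gT}) :
  L <| G -> nilpotent L -> cyclic (G / L) -> cyclic (G / 'F(G)).
Proof.
move=> nsLG nilL cycGL.
have sLF : L \subset 'F(G) by apply: Fitting_max.
rewrite -(isog_cyclic (third_isog sLF nsLG (Fitting_normal G))).
exact: quotient_cyclic.
Qed.

Lemma quotient_Fitting_pre (gT : finGroupType) (G N : {group gT}) :
  N <| G -> cyclic ((G / N) / 'F(G / N)) ->
  exists L : {group gT}, [/\ L <| G, N \subset L, 'F(G) \subset L,
    nilpotent (L / N) & cyclic (G / L)].
Proof.
move=> nsNG cyc; have [sNG nNG] := andP nsNG.
pose L := (coset N @*^-1 'F(G / N))%G.
have LN : L / N = 'F(G / N) by apply: cosetpreK.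
have sNL : N \subset L by apply: sub_cosetpre.
have nsLG : L <| G.
  have := Fitting_normal (G / N); rewrite -cosetpre_normal quotientGK //.
exists L; split=> //.
- rewrite /= -sub_quotient_pre ?(subset_trans (Fitting_sub G)) //.
  by rewrite Fitting_max ?quotient_normal ?Fitting_normal // quotient_nil ?Fitting_nil.
- by rewrite LN Fitting_nil.
by rewrite -(isog_cyclic (third_isog sNL nsNG nsLG)) /= LN.
Qed.

(** The lower central series of A ends in both N1 and N2. *)
Lemma nilpotent_TI_quo (gT : finGroupType) (A N1 N2 : {group gT}) :
    A \subset 'N(N1) -> A \subset 'N(N2) -> N1 :&: N2 = 1 ->
  nilpotent (A / N1) -> nilpotent (A / N2) -> nilpotent A.
Proof.
move=> nN1 nN2 ti /lcnP[n1 L1] /lcnP[n2 L2].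
have lcnN (N : {group gT}) n m :
    A \subset 'N(N) -> 'L_n.+1(A / N) = 1 -> n <= m -> 'L_m.+1(A) \subset N.
  move=> nN Ln le_nm; apply: subset_trans (lcn_sub_leq A (le_nm : n.+1 <= m.+1)) _.
  have nLN : 'L_n.+1(A) \subset 'N(N) by apply: subset_trans (lcn_sub _ _) nN.
  by rewrite -quotient_sub1 // -Ln /quotient morphim_lcn.
apply/lcnP; exists (maxn n1 n2); apply/trivgP; rewrite -ti subsetI.
by rewrite (lcnN N1 n1) ?leq_maxl // (lcnN N2 n2) ?leq_maxr.
Qed.

Lemma nilpotent_central_quo (gT : finGroupType) (A N : {group gT}) :
  N \subset 'Z(A) -> nilpotent (A / N) -> nilpotent A.
Proof.
move=> sNZ nilAN; rewrite -quotient_center_nil.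
have nsNA : N <| A by apply: sub_center_normal.
rewrite -(isog_nil (third_isog sNZ nsNA (center_normal A))).
exact: quotient_nil.
Qed.

(** If N1 is not centralised by L then N1 = [~: N1, L], so it lies in L and its
    image in the nilpotent group L / N2, isomorphic to N1, equals its own
    commutator with L / N2. *)
Lemma minnormal_cents_quo (gT : finGroupType) (G L N1 N2 : {group gT}) :
    minnormal N1 G -> N1 \subset G -> N2 <| G -> L <| G -> N1 :&: N2 = 1 ->
    nilpotent (L / N2) ->
  L \subset 'C(N1).
Proof.
move=> /minnormalP[ntN1 nN1G minN1] sN1G nsN2G /andP[sLG nLG] ti nilL.
have nN2G := normal_norm nsN2G.
rewrite centsC; apply/commG1P/eqP; apply: contraT => ntR.
have sRN1 : [~: N1, L] \subset N1 by rewrite commg_subl (subset_trans sLG).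
have defR : [~: N1, L] = N1 by apply: (minN1 [~: N1, L]%G); rewrite ?normsR.
have sN1L : N1 \subset L.
  by rewrite -defR commg_subr (subset_trans sN1G).
have nN2N1 : N1 \subset 'N(N2) by apply: subset_trans sN1L (subset_trans sLG nN2G).
have ntN1N2 : N1 / N2 != 1.
  rewrite -subG1 quotient_sub1 //; apply: contra ntN1 => sN12.
  by rewrite -subG1 -ti subsetI subxx.
have := nil_comm_properl nilL (quotientS N2 sN1L) ntN1N2 (_ : L / N2 \subset _).
rewrite -quotientR ?(subset_trans sLG) //= defR properxx => -> //.
by rewrite subsetI subxx quotient_norms // (subset_trans sLG).
Qed.

(** * Two minimal normal subgroups *)

Section TwoMinimalNormal.
Variables (gT : finGroupType) (G : {group gT}) (r : nat).
Hypotheses (hG : schmidt_subnormal_or_modular G) (solG : solvable G).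
Hypotheses (r_pr : prime r) (abelGF : r.-abelem (G / 'F(G))).

Let derF : G^`(1) \subset 'F(G).
Proof.
exact: der1_min (normal_norm (Fitting_normal G)) (abelem_abelian abelGF).
Qed.

Let FX x : x \in G -> x ^+ r \in 'F(G).
Proof.
move=> Gx; have nFx := subsetP (normal_norm (Fitting_normal G)) x Gx.
rewrite coset_idr ?groupX // morphX //.
by have [_ /(_ _ (mem_quotient _ Gx))] := abelemP r_pr abelGF.
Qed.

(** Since c generates G modulo C, and C centralises N, the subgroup N is
    irreducible under c alone; and an r-group N would make N <*> <[c]> an
    r-group, hence nilpotent. *)
Lemma schmidt_over_maximal (N C : {group gT}) c :
    minnormal N G -> N \subset G -> maximal C G -> 'F(G) \subset C ->
    C \subset 'C(N) -> ~~ (G \subset 'C(N)) ->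
    c \in G -> c \notin C -> r.-elt c ->
  [/\ minnormal N <[c]>, c \notin 'C(N), schmidt_group (N <*> <[c]>)
    & r^'.-group N].
Proof.
move=> minN sNG maxC sFC cCN ncGN Gc nCc r_c.
have [ntN nNG minN'] := minnormalP _ _ minN.
have [prC maxC'] := maxgroupP maxC; have sCG := proper_sub prC.
have defG : C <*> <[c]> = G.
  apply/eqP; apply: contraR nCc => neqG; rewrite -cycle_subG.
  rewrite -(maxC' (C <*> <[c]>)%G) ?joing_subl ?joing_subr //.
  by rewrite properEneq neqG join_subG sCG cycle_subG.
have ncN : c \notin 'C(N).
  by apply: contra ncGN; rewrite -defG join_subG cCN cycle_subG.
have minNc : minnormal N <[c]>.
  apply/minnormalP; split=> //; first by rewrite cycle_subG (subsetP nNG).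
  move=> K ntK nKc sKN; apply: minN' => //.
  rewrite -defG join_subG nKc andbT (subset_trans cCN) //.
  by apply: subset_trans (cent_sub _); apply: centS.
have [_ _ /is_abelemP[q q_pr abelN]] := minnormal_solvable minN sNG solG.
have scT : schmidt_group (N <*> <[c]>).
  apply: (schmidt_irreducible_cycle r_pr r_c (abelem_abelian abelN) minNc ncN).
  by apply: subsetP (FX Gc); apply: subset_trans cCN.
split=> //; apply: sub_in_pnat (abelem_pgroup abelN) => t _ /eqP->.
rewrite inE /=; apply: contraL scT => /eqP eq_qr.
rewrite /schmidt_group negb_and negbK; apply/orP; left.
apply: (@pgroup_nil _ r); rewrite /= norm_joinEr ?cycle_subG ?(subsetP nNG) //.
by rewrite pgroupM -{1}eq_qr (abelem_pgroup abelN).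
Qed.

(** Let a and b be r-elements of L1 and L2 outside 'F(G), in a common Sylow
    subgroup R, put c := a * b and consider the Schmidt subgroup
    T := N1 <*> <[c]>, contained in N1 <*> R, which meets N2 trivially.  It is not
    subnormal, because N2 = [~: N2, <[c]>].  If it is modular, take n in N2 with
    X := <[b ^ n]> and K := 'F(G) <*> <[c]>.  Then X :&: K lies in R, so the
    modular law puts (T <*> X) :&: K inside N1 <*> R.  This intersection
    contains [~ c, b ^ n] = [~ c, [~ b, n]] * [~ c, b], whose first factor thus
    lies in N2 :&: (N1 <*> R) = 1.  As c has no fixed points in N2, b commutes
    with n; but b does not centralise N2. *)
Lemma two_minnormal_contradiction (N1 N2 L1 L2 : {group gT}) :
    minnormal N1 G -> minnormal N2 G -> N1 \subset G -> N2 \subset G ->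
    N1 :&: N2 = 1 -> maximal L1 G -> maximal L2 G -> 
    L1 <| G -> L2 <| G -> L1 :&: L2 = 'F(G) ->
    L2 \subset 'C(N1) -> L1 \subset 'C(N2) ->
    ~~ (G \subset 'C(N1)) -> ~~ (G \subset 'C(N2)) ->
    ~~ (L1 \subset 'F(G)) -> ~~ (L2 \subset 'F(G)) ->
  False.
Proof.
move=> minN1 minN2 sN1G sN2G tiN maxL1 maxL2 nsL1 nsL2 defF cL2 cL1.
move=> ncN1 ncN2 nL1F nL2F.
have [sFL1 sFL2] : 'F(G) \subset L1 /\ 'F(G) \subset L2.
  by rewrite -defF subsetIl subsetIr.
have [R sylR] := Sylow_exists r G; have [sRG rR _] := and3P sylR.
have [sFG nFG] := andP (Fitting_normal G).
have defG : G \subset 'F(G) * R.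
  rewrite -quotientSK //.
  have sylRb := quotient_pHall (subset_trans sRG nFG) sylR.
  by rewrite (pHall_id sylRb (abelem_pgroup abelGF)).
have pick (L : {group gT}) : L <| G -> 'F(G) \subset L -> ~~ (L \subset 'F(G)) ->
    exists a, [/\ a \in L, a \in R & a \notin 'F(G)].
  move=> nsLG sFL /subsetPn[x Lx nFx].
  have /mulsgP[f a Ff Ra def_x] := subsetP defG x (subsetP (normal_sub nsLG) x Lx).
  rewrite def_x in Lx nFx; exists a; split=> //.
    by rewrite -(groupMl _ (subsetP sFL f Ff)).
  by apply: contra nFx; apply: groupM.
have [a [L1a Ra nFa]] := pick L1 nsL1 sFL1 nL1F.
have [b [L2b Rb nFb]] := pick L2 nsL2 sFL2 nL2F.
have nL2a : a \notin L2 by apply: contra nFa => L2a; rewrite -defF inE L1a.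
have nL1b : b \notin L1 by apply: contra nFb => L1b; rewrite -defF inE L1b.
pose c := a * b.
have Rc : c \in R by rewrite groupM.
have nL1c : c \notin L1 by rewrite groupMl.
have nL2c : c \notin L2 by rewrite groupMr.
have Gc := subsetP sRG c Rc; have Gb := subsetP sRG b Rb.
have r_c := mem_p_elt rR Rc; have r_b := mem_p_elt rR Rb.
have [minN1c _ scT r'N1] :=
  schmidt_over_maximal minN1 sN1G maxL2 sFL2 cL2 ncN1 Gc nL2c r_c.
have [minN2c ncN2c _ r'N2] :=
  schmidt_over_maximal minN2 sN2G maxL1 sFL1 cL1 ncN2 Gc nL1c r_c.
have [_ ncN2b _ _] :=
  schmidt_over_maximal minN2 sN2G maxL1 sFL1 cL1 ncN2 Gb nL1b r_b.
have [ntN1 nN1G _] := minnormalP _ _ minN1.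
have [ntN2 nN2G _] := minnormalP _ _ minN2.
have nN1R := subset_trans sRG nN1G.
(* N1 and N2 are r'-groups, so modulo N1 the intersection is both an r-group
   and an r'-group. *)
have tiN1R : (N1 <*> R) :&: N2 = 1.
  pose Y := ((N1 <*> R) :&: N2)%G.
  have nN1Y : Y \subset 'N(N1).
    by apply: subset_trans (subsetIr _ _) (subset_trans sN2G nN1G).
  have rY : r.-group (Y / N1).
    apply: pgroupS (quotientS N1 (subsetIl _ N2)) _.
    by rewrite /= quotientYidl // quotient_pgroup.
  have r'Y : r^'.-group (Y / N1).
    by apply: quotient_pgroup; apply: pgroupS r'N2; apply: subsetIr.
  have sYN1 : Y \subset N1.
    by rewrite -quotient_sub1 // subG1 trivg_card1 (pnat_1 rY r'Y).
  by apply/trivgP; rewrite -[[1]]tiN subsetI sYN1 subsetIr.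
have fpfc : 'C_N2[c] = 1 := minnormal_fpf minN2c ncN2c.
have nN2c : c \in 'N(N2) := subsetP nN2G c Gc.
pose T := (N1 <*> <[c]>)%G.
have sTN1R : T \subset N1 <*> R by rewrite genS // setUS // cycle_subG.
have sTG : T \subset G by rewrite join_subG sN1G cycle_subG.
have [subT | [_ _ modT]] := hG sTG scT.
  have /negP[] := ntN2; rewrite -subG1 -tiN1R subsetI subxx andbT.
  apply: subset_trans sTN1R; apply: (subnormal_comm_sub (A := <[c]>%G) subT) sN2G _ _.
    exact: joing_subr.
  exact: fpf_sub_comm.
case/negP: ncN2b; apply/centP=> n N2n; apply/commgP.
have Gn := subsetP sN2G n N2n.
pose K := ('F(G) <*> <[c]>)%G.
have sKG : K \subset G by rewrite join_subG sFG cycle_subG.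
have sTK : T \subset K.
  rewrite join_subG joing_subr andbT; apply: subset_trans (joing_subl _ _).
  have [_ _ /is_abelemP[q q_pr abelN1]] := minnormal_solvable minN1 sN1G solG.
  have nilN1 := abelian_nil (abelem_abelian abelN1).
  by apply: Fitting_max nilN1; rewrite /normal sN1G.
pose X := <[b ^ n]>%G.
have cFN2 : 'F(G) \subset 'C(N2) := subset_trans sFL1 cL1.
(* An element of X :&: K lies in L2 :&: K = 'F(G); being in R :^ n and
   centralised by n, it lies in R. *)
have XKR : X :&: K \subset R.
  apply/subsetP=> x /setIP[Xx Kx].
  have L2x : x \in L2.
    by apply: subsetP Xx; rewrite cycle_subG memJ_norm // (subsetP (normal_norm nsL2)).
  have Fx : x \in 'F(G).
    have : x \in 'F(G) * <[c]> by rewrite -norm_joinEr ?cycle_subG // (subsetP nFG).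
    case/mulsgP=> f _ Ff /cycleP[i ->] def_x.
    rewrite def_x groupM //.
    have L2ci : c ^+ i \in L2 by rewrite -(groupMl _ (subsetP sFL2 f Ff)) -def_x.
    have [/dvdnP[k ->] | r'i] := boolP (r %| i).
      by rewrite mulnC expgM groupX // FX.
    have gen_ci : generator <[c]> (c ^+ i).
      have [e oc] := p_natP r_c.
      by rewrite generator_coprime oc coprimeXl // prime_coprime.
    case/negP: nL2c; rewrite -cycle_subG (eqP gen_ci : <[c]> = <[c ^+ i]>).
    by rewrite cycle_subG.
  have : x \in R :^ n.
    by apply: subsetP Xx; rewrite cycle_subG memJ_conjg.
  case/imsetP=> y Ry def_x.
  have Fy : y \in 'F(G).
    by rewrite -(memJ_norm y (subsetP nFG n Gn)) -def_x.
  rewrite def_x; suff -> : y ^ n = y by [].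
  by apply/conjg_fixP/commgP; apply: (centsP cFN2).
have defV : T <*> (X :&: K) = (T <*> X) :&: K.
  by apply: modT; rewrite // cycle_subG groupJ.
have Ve : [~ c, b ^ n] \in N1 <*> R.
  have sV : T <*> (X :&: K) \subset N1 <*> R.
    by rewrite join_subG sTN1R (subset_trans XKR) ?joing_subr.
  apply: subsetP sV _ _; rewrite defV inE; apply/andP; split.
    rewrite groupR //.
      by rewrite -cycle_subG (subset_trans (joing_subr N1 _)) ?joing_subl.
    by rewrite -cycle_subG joing_subr.
  apply: subsetP (joing_subl _ _) _ _; apply: subsetP derF _ _.
  by rewrite mem_commg // groupJ.
have N2m : [~ b, n] \in N2.
  have sR : [~: G, N2] \subset N2 by rewrite commg_subr.
  by apply: subsetP sR _ (mem_commg Gb N2n).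
have Fcb : [~ c, b] \in 'F(G) by apply: subsetP derF _ (mem_commg Gc Gb).
have Rcb : [~ c, b] \in R by rewrite groupR.
have fixcb : [~ c, b] ^ [~ b, n] = [~ c, b].
  by apply/conjg_fixP/commgP; apply: (centsP cFN2).
have cm1 : [~ c, [~ b, n]] = 1.
  apply/eqP; rewrite -in_set1 -[[set 1]]tiN1R inE; apply/andP; split.
    have : [~ c, b * [~ b, n]] \in N1 <*> R by rewrite commgEl mulKVg.
    rewrite commgMJ fixcb groupMr //.
    by apply: subsetP (joing_subr _ _) _ _.
  have sR : [~: G, N2] \subset N2 by rewrite commg_subr.
  by apply: subsetP sR _ (mem_commg Gc N2m).
rewrite -in_set1 -[[set 1]]fpfc inE N2m /=.
by apply/cent1P/commgP; rewrite commg1_sym cm1.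
Qed.
End TwoMinimalNormal.

(** * The induction *)

(** A maximal subgroup H not containing N, which exists because 'Phi(G) = 1, is
    a complement of N; uniqueness of N makes it act faithfully. *)
Lemma monolithic_cyclic_quo_Fitting (gT : finGroupType) (G N : {group gT}) :
    schmidt_subnormal_or_modular G -> solvable G -> 'Phi(G) = 1 ->
    minnormal N G -> N \subset G ->
    (forall M : {group gT}, minnormal M G -> M \subset G -> M :=: N) ->
  cyclic (G / 'F(G)).
Proof.
move=> hG solG Phi1 minN sNG uniqN.
have [ntN nNG minN'] := minnormalP _ _ minN.
have nsNG : N <| G by rewrite /normal sNG.
have [_ _ /is_abelemP[p p_pr abelN]] := minnormal_solvable minN sNG solG.
have abN := abelem_abelian abelN.
have /existsP[H /andP[maxH nNH]] :
    [exists H : {group gT}, maximal H G && ~~ (N \subset H)].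
  apply: contraR ntN => /existsPn maxN; rewrite -subG1 -Phi1.
  apply/bigcapsP=> H; case/predU1P=> [-> //|maxH].
  by have := maxN H; rewrite maxH /= negbK.
have [prH maxH'] := maxgroupP maxH; have sHG := proper_sub prH.
have nNHH : H \subset 'N(N) := subset_trans sHG nNG.
have defG : N <*> H = G.
  apply/eqP; apply: contraR nNH => neqG.
  rewrite -(maxH' (N <*> H)%G) ?joing_subl ?joing_subr //.
  by rewrite properEneq neqG join_subG sNG.
have tiNH : N :&: H = 1.
  apply/eqP; apply: contraR nNH => ntI; apply/setIidPl.
  apply: (minN' (N :&: H)%G) => //; last exact: subsetIl.
  rewrite -defG join_subG; apply/andP; split; last by rewrite normsI ?normG.
  by rewrite sub_abelian_norm ?subsetIl.
have sdG : N ><| H = G by rewrite sdprodE // -norm_joinEr.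
have cHN : 'C_H(N) = 1.
  apply/eqP; apply: contraR nNH => ntC.
  have nCG : G \subset 'N('C_H(N)).
    rewrite -defG join_subG; apply/andP; split.
      by rewrite cents_norm // centsC subsetIr.
    by rewrite normsI ?normG // norms_cent.
  have [M minM sMC] := minnormal_exists ntC nCG.
  have sMH : M \subset H := subset_trans sMC (subsetIl _ _).
  by rewrite -(uniqN M minM) ?(subset_trans sMH).
have Op1 : 'O_p(H) = 1.
  apply/trivgP; rewrite -cHN subsetI pcore_sub /=.
  pose P := (N <*> 'O_p(H))%G.
  have nsPG : P <| G.
    rewrite /normal join_subG sNG (subset_trans (pcore_sub p H) sHG) /=.
    rewrite -{1}defG join_subG (subset_trans (joing_subl N 'O_p(H))) ?normG //=.
    by rewrite normsY // normal_norm // pcore_normal.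
  have nOp : 'O_p(H) \subset 'N(N) := subset_trans (pcore_sub p H) nNHH.
  have pP : p.-group P.
    by rewrite /= norm_joinEr // pgroupM (abelem_pgroup abelN) pcore_pgroup.
  apply: subset_trans (joing_subr N _) _.
  apply: (@minnormal_cents_quo _ G P N 1%G) => //; first exact: normal1.
    by rewrite setIC setI1g. 
  by rewrite quotient_nil // (pgroup_nil pP).
have cycH : cyclic H.
  by apply: primitive_compl_cyclic hG abelN minN sdG cHN (solvableS sHG solG) Op1.
apply: (cyclic_quo_Fitting nsNG (abelian_nil abN)).
by rewrite -defG norm_joinEr // quotientMidl quotient_cyclic.
Qed.

(** If G / 'F(G) is not cyclic, it has an elementary abelian subgroup of rank 2;
    the preimage of the latter has the same Fitting subgroup as G and
    a noncyclic quotient, so it is G by induction.  The cyclic quotients G / L1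
    and G / L2 of the elementary abelian group G / 'F(G) then have order at most
    r; and L1 = G is excluded, since it would make L2 equal to 'F(G). *)
Lemma two_minnormal_cyclic_quo_Fitting
    (gT : finGroupType) (G N1 N2 : {group gT}) :
    schmidt_subnormal_or_modular G -> solvable G ->
    (forall E : {group gT}, E \proper G -> cyclic (E / 'F(E))) ->
    (forall N : {group gT}, N <| G -> N :!=: 1 ->
       cyclic ((G / N) / 'F(G / N))) ->
    minnormal N1 G -> minnormal N2 G -> N1 \subset G -> N2 \subset G ->
    N1 :!=: N2 ->
  cyclic (G / 'F(G)).
Proof.
move=> hG solG IHs IHq minN1 minN2 sN1G sN2G neqN; apply: contraT => ncyc.
have [ntN1 nN1G minN1'] := minnormalP _ _ minN1.
have [ntN2 nN2G minN2'] := minnormalP _ _ minN2.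
have nsN1 : N1 <| G by rewrite /normal sN1G.
have nsN2 : N2 <| G by rewrite /normal sN2G.
have tiN : N1 :&: N2 = 1.
  apply: contraNeq neqN => ntI; have nI : G \subset 'N(N1 :&: N2) by apply: normsI.
  by rewrite -(minN1' (N1 :&: N2)%G) ?subsetIl //= (minN2' (N1 :&: N2)%G) ?subsetIr.
have [L1 [nsL1 sN1L1 sFL1 nilL1 cycL1]] :=
  quotient_Fitting_pre nsN1 (IHq _ nsN1 ntN1).
have [L2 [nsL2 sN2L2 sFL2 nilL2 cycL2]] :=
  quotient_Fitting_pre nsN2 (IHq _ nsN2 ntN2).
have [sL1G nL1G] := andP nsL1; have [sL2G nL2G] := andP nsL2.
have defF : L1 :&: L2 = 'F(G).
  apply/eqP; rewrite eqEsubset [X in _ && X]subsetI sFL1 sFL2 !andbT.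
  apply: Fitting_max; first by rewrite normalI.
  apply: (@nilpotent_TI_quo _ _ N1 N2) => //.
  - by rewrite subIset // (subset_trans sL1G).
  - by rewrite subIset // (subset_trans sL1G).
  - by apply: nilpotentS nilL1; apply: quotientS; apply: subsetIl.
  by apply: nilpotentS nilL2; apply: quotientS; apply: subsetIr.
have der1F : G^`(1) \subset 'F(G).
  by rewrite -defF subsetI !der1_min ?cyclic_abelian.
have abGF : abelian (G / 'F(G)) := sub_der1_abelian der1F.
have [sFG nFG] := andP (Fitting_normal G).
have [r r_pr abelGF] : exists2 r, prime r & r.-abelem (G / 'F(G)).
  have [r r_pr def_r] := rank_witness (G / 'F(G)).
  exists r => //.
  have /p_rank_geP[Eb /pnElemP[sEG abelE dimE]] : 2 <= 'r_r(G / 'F(G)).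
    by rewrite -def_r ltnNge -abelian_rank1_cyclic.
  pose E := (coset 'F(G) @*^-1 Eb)%G.
  have sFE : 'F(G) \subset E by apply: sub_cosetpre.
  have sEG' : E \subset G by rewrite sub_cosetpre_quo ?Fitting_normal.
  have nsEG : E <| G by apply: sub_der1_normal sEG'; apply: subset_trans sFE.
  have defFE : 'F(E) = 'F(G).
    apply/eqP; rewrite eqEsubset !Fitting_max ?Fitting_nil //.
      by apply: normalS (Fitting_normal G).
    exact: char_normal_trans (Fitting_char E) nsEG.
  have [prE | ] := boolP (E \proper G); last first.
    rewrite properEneq sEG' andbT negbK => /eqP eqEG.
    have : E / 'F(G) = Eb by apply: cosetpreK.
    by rewrite eqEG => ->.
  have := IHs E prE; rewrite defFE /= cosetpreK.
  by rewrite (abelem_cyclic abelE) dimE.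
have maxL (L K : {group gT}) :
    K \subset G -> L <| G -> 'F(G) \subset L -> cyclic (G / L) ->
    cyclic (G / K) -> L :&: K = 'F(G) -> maximal L G.
  move=> sKG nsL sFL cycL cycK defI; have [sLG nLG] := andP nsL.
  have abelL : r.-abelem (G / L).
    rewrite -(isog_abelem (third_isog sFL (Fitting_normal G) nsL)).
    exact: quotient_abelem.
  apply: p_index_maximal => //; rewrite -card_quotient //.
  have [k oL] := p_natP (abelem_pgroup abelL).
  move: cycL; rewrite (abelem_cyclic abelL) oL pfactorK //.
  case: k oL => [|[]] // oL _.
  have sGL : G \subset L by rewrite -quotient_sub1 // (card1_trivg oL).
  by case/negP: ncyc; rewrite -defI (setIidPr (subset_trans sKG sGL)).
have maxL1 : maximal L1 G by apply: (maxL L1 L2).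
have maxL2 : maximal L2 G by apply: (maxL L2 L1); rewrite // setIC.
have cL2 : L2 \subset 'C(N1) by apply: (minnormal_cents_quo minN1 sN1G nsN2).
have cL1 : L1 \subset 'C(N2).
  by apply: (minnormal_cents_quo minN2 sN2G nsN1) => //; rewrite setIC.
have nLF (L K : {group gT}) : maximal L G -> maximal K G -> L :&: K = 'F(G) ->
   cyclic (G / L) -> ~~ (L \subset 'F(G)).
  move=> maxLG maxKG defI cycL; apply: contra ncyc => sLF.
  rewrite -(_ : L :=: 'F(G)) //.
  by apply/eqP; rewrite eqEsubset sLF -defI subsetIl.
have ncN (N L K : {group gT}) : maximal L G -> maximal K G -> L :&: K = 'F(G) ->
   cyclic (G / L) -> N <| G -> L <| G -> N \subset L -> nilpotent (L / N) ->
   ~~ (G \subset 'C(N)).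
  move=> maxLG maxKG defI cycL nsN nsL sNL nilLN.
  apply: contra (nLF L K maxLG maxKG defI cycL) => cNG.
  apply: Fitting_max => //; apply: nilpotent_central_quo nilLN.
  rewrite subsetI sNL centsC; exact: subset_trans (normal_sub nsL) cNG.
have defF' : L2 :&: L1 = 'F(G) by rewrite setIC.
case: (@two_minnormal_contradiction _ G r hG solG r_pr abelGF N1 N2 L1 L2) => //.
- exact: (ncN N1 L1 L2).
- exact: (ncN N2 L2 L1).
- exact: (nLF L1 L2).
exact: (nLF L2 L1).
Qed.

Lemma schmidt_subnormal_or_modular_cyclic_quo_Fitting
    (gT : finGroupType) (G : {group gT}) :
  schmidt_subnormal_or_modular G -> cyclic (G / 'F(G)).
Proof.
have [n] := ubnP #|G|; elim: n => // n IHn in gT G *; rewrite ltnS => leGn hG.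
have solG := schmidt_subnormal_or_modular_sol hG.
have [-> | ntG] := eqVneq G 1%G; first by rewrite quotient1 cyclic1.
have IHs (E : {group gT}) : E \proper G -> cyclic (E / 'F(E)).
  move=> prE; apply: IHn; first exact: leq_trans (proper_card prE) leGn.
  exact: schmidt_subnormal_or_modularS (proper_sub prE) hG.
have IHq (N : {group gT}) : N <| G -> N :!=: 1 -> cyclic ((G / N) / 'F(G / N)).
  move=> nsNG ntN; apply: IHn.
    exact: leq_trans (ltn_quotient ntN (normal_sub nsNG)) leGn.
  exact: schmidt_subnormal_or_modular_quo.
have [Phi1 | ntPhi] := eqVneq 'Phi(G) 1; last first.
  have nsPhi := Phi_normal G; have nPhi := normal_norm nsPhi.
  have [L [nsLG _ _ nilL cycL]] := quotient_Fitting_pre nsPhi (IHq _ nsPhi ntPhi).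
  apply: (cyclic_quo_Fitting nsLG _ cycL).
  by apply: nilpotent_quo_sub_Phi nsLG nPhi _ nilL; apply: subsetIr.
have [N minN sNG] := minnormal_exists ntG (normG G).
have [/existsP[M /and3P[minM sMG neqM]] | /existsPn uniqN] :=
  boolP [exists M : {group gT}, [&& minnormal M G, M \subset G & M != N]].
  exact: (two_minnormal_cyclic_quo_Fitting hG solG IHs IHq minM minN).
apply: (monolithic_cyclic_quo_Fitting hG solG Phi1 minN sNG) => M minM sMG.
by apply/eqP; have := uniqN M; rewrite minM sMG /= negbK.
Qed.

Theorem theorem1 (gT : finGroupType) (G : {group gT})
    (hG : forall S : {group gT}, S \subset G -> schmidt_group S ->
            S <|<| G \/ modular_subgroup S G) :
  cyclic (G / 'F(G)).
Proof. exact: schmidt_subnormal_or_modular_cyclic_quo_Fitting. Qed.
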